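(* Let $\gamma>0$ and let $f\in\mathcal P_\gamma'(\mathbb R)\cap L^1(\mathbb R)$ be real-valued and not almost everywhere zero. For any $0<t_1<t_2$, the edge contours of $f$ that intersect the line $t=t_2$ are a subset of those that intersect the line $t=t_1$; that is, every edge contour of $f$ that intersects the line $t=t_2$ also intersects the line $t=t_1$.
   Context: For $\gamma>0$, $\mathcal P_\gamma=\mathcal P_\gamma(\mathbb R)$ is the space of smooth functions $\psi$ on $\mathbb R$ such that $\lim_{|x|\to\infty}e^{-\gamma|x|}\psi^{(n)}(x)=0$ for every $n\ge0$, with topology generated by the seminorms $\sup_x|e^{-\gamma|x|}\psi^{(n)}(x)|$. $\mathcal P_\gamma'$ is its topological dual. An element of $\mathcal P_\gamma'\cap L^1(\mathbb R)$ is an integrable function whose associated distribution $\phi\mapsto\int f\phi$ extends to an element of $\mathcal P_\gamma'$. Let $G_\sigma(x)=(2\pi)^{-1/2}\sigma^{-1}e^{-x^2/(2\sigma^2)}$ and $F(x,t)=f*G_{\sqrt t}(x)$ on the upper half-plane $H_+=\mathbb R\times(0,\infty)$, with coordinates $(x,t)$. $F$ is real-analytic on $H_+$ and solves the heat equation $F_t=\tfrac12F_{xx}$. Edge contours: for each zero $(x_0,t_0)\in H_+$ of $F_{xx}$ there are a neighborhood $W\subset H_+$ of $(x_0,t_0)$ and finitely many injective real-analytic maps $(\chi_j,\tau_j):(-\epsilon_j,\epsilon_j)\to W$, $j=1,\dots,k$, with $(\chi_j(0),\tau_j(0))=(x_0,t_0)$, whose images intersect only at $(x_0,t_0)$ and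 whose union of images is exactly the zero set of $F_{xx}$ in $W$. By analytic continuation of these local parameterizations, the zero set of $F_{xx}$ in $H_+$ is uniquely described as a union of real-analytic curves or curve segments that have locally injective real-analytic parameterizations of this form around each point, that have endpoints (if any) only on the line $t=0$, and whose mutual intersections form a discrete subset of $H_+$. These curves and curve segments are the edge contours of $f$. *)

(* Defs.v *)
From HB Require Import structures.
From mathcomp Require Import all_boot all_order all_algebra.
From mathcomp Require Import all_classical all_reals all_analysis.

Set Implicit Arguments.
Unset Strict Implicit.
Unset Printing Implicit Defensive.

Import Order.TTheory GRing.Theory Num.Theory.
Import numFieldNormedType.Exports.

Local Open Scope classical_set_scope.
Local Open Scope ring_scope.

Section distributions.
Context {R : realType}.
Implicit Types (gamma : R) (f phi psi : R -> R) (L : (R -> R) -> R).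

Definition smooth psi : Prop := forall n x, derivable (derive1n n psi) x 1.

Definition weighted gamma n psi (x : R) : R :=
  expR (- (gamma * `|x|)) * derive1n n psi x.

(* The space P_gamma, with real-valued functions: a complex functional on the
   complex space restricts to a real one by taking real parts, and a real one
   complexifies, so for real f the choice of scalars is immaterial. *)
Definition Pspace gamma : set (R -> R) :=
  [set psi | smooth psi /\
    forall n, weighted gamma n psi x @[x --> +oo] --> (0 : R) /\
              weighted gamma n psi x @[x --> -oo] --> (0 : R)].

(* Finite on P_gamma, where the weighted derivatives are continuous and vanish
   at infinity. *)
Definition seminormP gamma n psi : R :=
  sup (range (fun x => `|weighted gamma n psi x|)).

(* Basic neighborhoods of psi0 in the topology generated by the seminorms. *)
Definition basicP gamma (N : nat) (d : R) (psi0 : R -> R) : set (R -> R) :=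
  [set psi | Pspace gamma psi /\
    forall n, (n <= N)%N -> seminormP gamma n (psi \- psi0) < d].

(* L belongs to the topological dual P_gamma'; only its values on P_gamma
   matter. *)
Definition Pdual gamma L : Prop :=
  (forall (a : R) phi psi, Pspace gamma phi -> Pspace gamma psi ->
     L (fun x => a * phi x + psi x) = a * L phi + L psi) /\
  (forall psi0, Pspace gamma psi0 -> forall e : R, 0 < e ->
     exists (N : nat) (d : R), 0 < d /\
       forall psi, basicP gamma N d psi0 psi -> `|L psi - L psi0| < e).

Definition test_function phi : Prop :=
  smooth phi /\ compact (closure [set x | phi x != 0]).

Definition Pdual_L1 gamma f : Prop :=
  (@lebesgue_measure R).-integrable setT (EFin \o f) /\
  exists L, Pdual gamma L /\
    forall phi, test_function phi ->
      L phi = \int[@lebesgue_measure R]_x (f x * phi x).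

End distributions.

Section heat_evolution.
Context {R : realType}.
Implicit Types (f g : R -> R).

Definition gaussian (sigma x : R) : R :=
  (Num.sqrt (2 * pi))^-1 * sigma^-1 * expR (- (x ^+ 2 / (2 * sigma ^+ 2))).

Definition convolution f g (x : R) : R :=
  \int[@lebesgue_measure R]_y (f y * g (x - y)).

Definition scale_space f (x t : R) : R :=
  convolution f (gaussian (Num.sqrt t)) x.

Definition scale_space_xx f (x t : R) : R :=
  derive1n 2 (fun y => scale_space f y t) x.

Definition upper_half_plane : set (R * R) := [set p | 0 < p.2].

Definition edge_set f : set (R * R) :=
  [set p | upper_half_plane p /\ scale_space_xx f p.1 p.2 = 0].

End heat_evolution.

Section edge_contours.
Context {R : realType}.
Implicit Types (Z C : set (R * R)) (p : R * R) (c : R -> R * R).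

Definition real_analytic_at (g : R -> R) (s0 : R) : Prop :=
  exists a : R^nat, \forall s \near s0, pseries a (s - s0) @ \oo --> g s.

Definition real_analytic_curve_at c (s0 : R) : Prop :=
  real_analytic_at (fun s => (c s).1) s0 /\
  real_analytic_at (fun s => (c s).2) s0.

(* The local form of the zero set Z at p: the maps br j = (chi_j, tau_j) are
   considered on ]- eps j, eps j[ only. *)
Definition local_branches Z p (W : set (R * R)) (k : nat)
    (eps : 'I_k -> R) (br : 'I_k -> R -> R * R) : Prop :=
  let I j : set R := `]- eps j, eps j[%classic in
  [/\ nbhs p W /\ W `<=` upper_half_plane,
      forall j, [/\ 0 < eps j,
        forall s, I j s -> real_analytic_curve_at (br j) s,
        {in I j &, injective (br j)},
        br j 0 = p &
        br j @` I j `<=` W],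
      forall i j, i != j -> (br i @` I i) `&` (br j @` I j) = [set p] &
      \bigcup_j (br j @` I j) = Z `&` W].

(* A curve obtained by analytic continuation of the local branches of Z:
   around each parameter s0, up to translation of the parameter, c is one of
   the branches of Z at c s0.  In particular c is real-analytic and locally
   injective.  There is no loss in taking all of R as the parameter domain:
   every open interval is analytically diffeomorphic to R, and a closed curve
   is traversed periodically. *)
Definition continues_branches Z c : Prop :=
  forall s0 : R, exists (W : set (R * R)) (k : nat) (eps : 'I_k -> R)
      (br : 'I_k -> R -> R * R),
    local_branches Z (c s0) W eps br /\
    exists j, \forall s \near (0 : R), c (s0 + s) = br j s.

Definition endpoint c p : Prop :=
  c s @[s --> +oo] --> p \/ c s @[s --> -oo] --> p.

Definition contour_curve Z C : Prop :=
  exists c, [/\ C = range c, continues_branches Z c &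
    forall p, endpoint c p -> p.2 = 0].

Definition discrete_subset (S : set (R * R)) : Prop := S `<=` isolated S.

(* CC is the collection of the edge contours of f, each contour being regarded
   as a subset of the half-plane: the description of the zero set of F_xx as a
   union of maximal analytic curves, which is unique. *)
Definition edge_contours (f : R -> R) (CC : set (set (R * R))) : Prop :=
  [/\ \bigcup_(C in CC) C = edge_set f,
      forall C, CC C -> contour_curve (edge_set f) C &
      discrete_subset
        [set p | exists C C', [/\ CC C, CC C', C <> C', C p & C' p]]].

Definition horizontal_line (t : R) : set (R * R) := [set p | p.2 = t].

Definition contours_meeting (CC : set (set (R * R))) (t : R) :
    set (set (R * R)) :=
  [set C | CC C /\ C `&` horizontal_line t !=set0].

End edge_contours.

(* Main.v *)
(* Write u for F_xx.  It solves the heat equation, and it tends to 0 as |x|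
   tends to infinity, uniformly for t in a compact subset of ]0, +oo[.  By the
   maximum principle, every point with u <> 0 is joined to any lower time level
   tb > 0 by a path x = g(t), a graph over time, along which u <> 0: otherwise
   a positive maximum of u - e t over the closure of the set reached by such
   paths would occur above the level tb.  A curve of zeros of u cannot cross
   these paths.

   First consequence: an arc of zeros whose two ends have the same height t and
   which stays below t has equal ends, since a path descending from a point
   between two distinct ends would be trapped by the arc.  Hence t has no local
   minimum along a contour.  A contour that meets t = t2 but not t = t1 stays
   above t1, so from some parameter on t decreases strictly along it, in one of
   the two directions.  Second consequence: x stays there between two descending
   paths, and then converges, because zeros of u are not dense at the limiting
   level.  So the contour has an endpoint at height t >= t1 > 0, which is
   excluded.

   It remains to see that u(., t) vanishes on no interval I.  Let m_n(x) be the
   integral of f(y) (x - y)^n exp(- b (x - y)^2), with b = 1 / (2 t).  If u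
   vanishes on I then, differentiating, 2 b m_(2k+2) = (2k+1) m_(2k) on I, so
   b^k m_(2k) / k! = m_0 (2k choose k) / 4^k, whose sum over k diverges unless
   m_0 = 0; but the partial sums are bounded by the L^1 norm of f, because
   partial sums of the exponential series satisfy exp(- w) sum w^k / k! <= 1.
   So all m_(2k) vanish on I, for b and then, expanding exponentials, for every
   rate b > 0.  Limits of combinations of the exp(- b (x - y)^2) include the
   indicator of |x - y| > r: f has mass 0 outside every interval centred in I.
   Thus the distribution function of f is symmetric about each point of I,
   hence has all small periods, hence is constant, and f = 0 almost
   everywhere. *)

Require Import Defs.
From HB Require Import structures.
From mathcomp Require Import all_boot all_order all_algebra.
From mathcomp Require Import all_classical all_reals all_analysis.
From mathcomp Require Import measurable_realfun ring lra.

Set Implicit Arguments.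
Unset Strict Implicit.
Unset Printing Implicit Defensive.

Import Order.TTheory GRing.Theory Num.Theory.
Import numFieldNormedType.Exports.
Local Open Scope classical_set_scope.
Local Open Scope ring_scope.

(** * Derivative tests at a maximum *)

Section calculus.
Context {R : realType}.
Implicit Types (f g : R -> R) (x d e : R).

Lemma ex_pos_lt2 (a b : R) : 0 < a -> 0 < b -> exists c, [/\ 0 < c, c < a & c < b].
Proof.
move=> a0 b0; have [ab|ba] := leP a b; first by exists (a / 2); split; lra.
by exists (b / 2); split; lra.
Qed.

Lemma is_derive1P f x (l : R) : is_derive x 1 f l ->
  forall e, 0 < e -> exists d, 0 < d /\
    forall h, h != 0 -> `|h| < d -> `|(f (x + h) - f x) / h - l| < e.
Proof.
move=> [df dl] e e0.
have : h^-1 *: ((f \o shift x) (h *: 1) - f x) @[h --> 0^'] --> l.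
  by rewrite -dl; exact: df.
move/cvgrPdist_lt => /(_ e e0) [d /= d0 dh].
exists d; split => // h h0 hd.
have := dh h; rewrite /= sub0r normrN => /(_ hd h0).
by rewrite distrC [_%:A]mulr1 /= mulrC (addrC x) -[_ *: _]/(_ * _) mulrC.
Qed.

Lemma is_derive1_continuous f x (l : R) : is_derive x 1 f l ->
  {for x, continuous f}.
Proof. by move=> [df _]; apply: differentiable_continuous; apply/derivable1_diffP. Qed.

(** If [l] were positive, [f1], which is 0 at the maximum, would be positive just to the right of
    [x], and the mean value theorem would give [f (x + h) > f x]. *)
Lemma second_derivative_max f f1 (l : R) x d : 0 < d ->
  (forall z, `|z - x| < d -> is_derive z 1 f (f1 z)) ->
  is_derive x 1 f1 l ->
  (forall z, `|z - x| < d -> f z <= f x) -> l <= 0.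
Proof.
move=> d0 df df1 fmax; rewrite leNgt; apply/negP => l0.
have itvd z : z \in `]x - d, x + d[ -> `|z - x| < d.
  by rewrite in_itv /= ltr_distl.
have f1x : f1 x = 0.
  have := @derive1_at_max R f (x - d) (x + d) x _ _ _ _.
  have xx : `|x - x| < d by rewrite subrr normr0.
  move=> /(_ _ _ _ _) H.
  have : is_derive x 1 f 0.
    apply: H; first by lra.
    - by move=> t /itvd/df[].
    - by rewrite in_itv /=; lra.
    - by move=> t /itvd/fmax.
  by move=> [_ <-]; have [_ ->] := df x xx.
have [d' [d'0 dd]] := @is_derive1P _ _ _ df1 l l0.
have [h [h0 hd hd']] := ex_pos_lt2 d0 d'0.
have dfz z : z \in `[x, x + h] -> is_derive z 1 f (f1 z).
  rewrite in_itv /= => /andP[xz zx]; apply: df.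
  by rewrite ger0_norm; lra.
have xh : x < x + h by rewrite ltrDl.
have cf : {within `[x, x + h], continuous f}.
  by apply: derivable_within_continuous => z zI; have [] := dfz z zI.
have df' z : z \in `]x, x + h[ -> is_derive z 1 f (f1 z).
  by move=> zI; apply: dfz; apply: subset_itv_oo_cc zI.
have [c cI E] := MVT xh df' cf.
move: cI; rewrite in_itv /= => /andP[xc cx].
have := dd (c - x); rewrite subr_eq0 gt_eqF // => /(_ isT).
rewrite gtr0_norm ?subr_gt0 // => /(_ ltac:(lra)).
rewrite addrCA subrr addr0 f1x subr0 ltr_norml => /andP[cl _].
have f1c : 0 < f1 c / (c - x) by lra.
have f1c' : 0 < f1 c by move: f1c; rewrite pmulr_lgt0 // invr_gt0 subr_gt0.
have := fmax (x + h); rewrite addrAC subrr add0r gtr0_norm // => /(_ hd).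
have : 0 < f1 c * (x + h - x) by rewrite mulr_gt0 // addrAC subrr add0r.
lra.
Qed.

(** The left difference quotients at [x] are at least [e]. Only points to the left are compared, as
    needed for a maximum over past times. *)
Lemma derivative_left_ge f (l e : R) x d : 0 < d ->
  is_derive x 1 f l ->
  (forall z, x - d < z -> z <= x -> f z - e * z <= f x - e * x) -> e <= l.
Proof.
move=> d0 df fmax; rewrite leNgt; apply/negP => le0.
have el : 0 < e - l by lra.
have [d' [d'0 dd]] := @is_derive1P _ _ _ df _ el.
have [h [h0 hd hd']] := ex_pos_lt2 d0 d'0.
have := dd (- h); rewrite oppr_eq0 gt_eqF // normrN gtr0_norm // => /(_ isT hd').
rewrite ltr_norml => /andP[_].
have F := fmax (x - h) ltac:(lra) ltac:(lra).
have : e <= (f (x - h) - f x) / - h; last by lra.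
rewrite invrN mulrN -mulNr ler_pdivlMr //; lra.
Qed.

End calculus.

(** * The heat equation: maximum principle and descending paths *)

Definition heat_solution {R : realType} (u : R -> R -> R) : Prop :=
  exists ux uxx : R -> R -> R, forall x t : R, 0 < t ->
    [/\ is_derive x 1 (u^~ t) (ux x t),
        is_derive x 1 (ux^~ t) (uxx x t) &
        is_derive t 1 (u x) (uxx x t / 2)].

(** At such a point the space variable gives [uxx <= 0], while the penalty [e * t] forces the time
    derivative to be at least [e > 0]; this contradicts the equation. *)
Lemma heat_no_backward_max {R : realType} (u : R -> R -> R) (x0 t0 d e : R) :
  heat_solution u -> 0 < t0 -> 0 < d -> 0 < e ->
  (forall x t, `|x - x0| < d -> t0 - d < t -> t <= t0 ->
     u x t - e * t <= u x0 t0 - e * t0) -> False.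
Proof.
move=> [ux [uxx H]] t00 d0 e0 umax.
have [_ Hxx Ht] := H x0 t0 t00.
have : uxx x0 t0 <= 0.
  apply: (@second_derivative_max R (u^~ t0) (ux^~ t0) _ x0 d) => //.
    by move=> z _; have [] := H z t0 t00.
  move=> z zd; have := umax z t0 zd.
  by rewrite ltrBlDr ltrDl d0 lexx => /(_ isT isT); rewrite lerD2r.
have : e <= uxx x0 t0 / 2.
  apply: (@derivative_left_ge R (u x0) _ _ t0 d) => // z dz zt.
  by apply: umax => //; rewrite subrr normr0.
lra.
Qed.

Definition vanishes_at_infinity {R : realType} (u : R -> R -> R) : Prop :=
  forall a b : R, 0 < a -> a < b -> forall e, 0 < e -> exists B, 0 < B /\
    forall x t, a <= t <= b -> B <= `|x| -> `|u x t| < e.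

Definition continuous_on_half_plane {R : realType} (u : R -> R -> R) : Prop :=
  forall x t : R, 0 < t -> {for (x, t), continuous (fun p : R * R => u p.1 p.2)}.

Section descent.
Context {R : realType} (u : R -> R -> R).
Hypothesis uC : continuous_on_half_plane u.

Lemma half_plane_box (x t e : R) : 0 < t -> 0 < e -> exists d, 0 < d /\
  forall x' t', `|x' - x| < d -> `|t' - t| < d -> `|u x' t' - u x t| < e.
Proof.
move=> t0 e0; have /cvgrPdist_lt /(_ e e0) := uC (x := x) t0.
move=> [[P Q] /= [/nbhs_ballP[d1 /= d10 Pd] /nbhs_ballP[d2 /= d20 Qd]] PQ].
have [d [d0 /ltW dd1 /ltW dd2]] := ex_pos_lt2 d10 d20.
exists d; split => // x' t' xd td.
rewrite distrC; apply: (PQ (x', t')); split => /=.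
  by apply: Pd; rewrite /ball /= distrC (lt_le_trans xd).
by apply: Qd; rewrite /ball /= distrC (lt_le_trans td).
Qed.

Lemma closure_box (A : set (R * R)) (c : R * R) (d : R) : closure A c -> 0 < d ->
  exists a, [/\ A a, `|a.1 - c.1| < d & `|a.2 - c.2| < d].
Proof.
move=> Ac d0; have [|a [Aa [/= a1 a2]]] := Ac (ball c d).
  exact: nbhsx_ballx.
by exists a; split => //; rewrite distrC.
Qed.

Variables (tb t' y : R).

(** The end points of the descending paths from [(y, t')]. The path [g] is a total function so that
    continuity needs no restriction; only its values between the heights [p.2] and [t'] matter. *)
Definition reached : set (R * R) := [set p | tb <= p.2 <= t' /\
  exists g : R -> R, [/\ continuous g, g t' = y, g p.2 = p.1 &
    forall r, p.2 <= r <= t' -> 0 < u (g r) r]].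

(** The path to [p] is continued by the segment from [p] to [q], which lies in the box around [c] by
    convexity. *)
Lemma reached_extend (c p q : R * R) (d : R) :
  (forall x t, `|x - c.1| < d -> `|t - c.2| < d -> 0 < u x t) ->
  `|p.1 - c.1| < d -> `|p.2 - c.2| < d ->
  `|q.1 - c.1| < d -> `|q.2 - c.2| < d ->
  tb <= q.2 -> q.2 < p.2 -> reached p -> reached q.
Proof.
case: p => p1 p2; case: q => q1 q2 /= box P1 P2 Q1 Q2 bq qp.
move=> [/= /andP[_ pt'] [g [gC gt' gp g0]]]; split => /=.
  by rewrite bq; lra.
pose k := (q1 - p1) / (p2 - q2).
have pq0 : 0 < p2 - q2 by lra.
(* Above height [p2] the second term vanishes and this is [g]; below it the first term is frozen at
   [p1] and the second runs along the segment. *)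
exists (fun r => g (Num.max r p2) + k * Num.max 0 (p2 - r)); split.
- move=> r; apply: cvgD.
    apply: continuous_comp; last exact: gC.
    apply: (@continuous_max R R idfun (cst p2)); first exact: cvg_id.
    exact: cvg_cst.
  apply: cvgM; first exact: cvg_cst.
  apply: (@continuous_max R R (cst 0) (fun r => p2 - r)); first exact: cvg_cst.
  by apply: cvgB; [exact: cvg_cst|exact: cvg_id].
- rewrite max_l // max_l ?mulr0 ?addr0 //; lra.
- rewrite max_r ?(ltW qp) // max_r ?(ltW pq0) // gp /k mulfVK ?gt_eqF //; lra.
- move=> r /andP[qr rt'].
  have [pr|rp] := leP p2 r.
    rewrite max_l; last lra.
    by rewrite mulr0 addr0 g0 // pr.
  rewrite max_r ?gp; last lra.
  have s0 : 0 < (p2 - r) / (p2 - q2) by rewrite divr_gt0 //; lra.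
  have s1 : (p2 - r) / (p2 - q2) <= 1 by rewrite ler_pdivrMr //; lra.
  have -> : p1 + k * (p2 - r) = p1 + (q1 - p1) * ((p2 - r) / (p2 - q2)).
    by rewrite /k; ring.
  move: s0 s1; set s := (p2 - r) / _ => s0 s1.
  by apply: box; rewrite ltr_norml; move: P1 P2 Q1 Q2; rewrite !ltr_norml; nra.
Qed.

Hypothesis uH : heat_solution u.
Hypothesis uV : vanishes_at_infinity u.

Lemma descent_pos : 0 < tb -> tb < t' -> 0 < u y t' ->
  exists g : R -> R, [/\ continuous g, g t' = y &
    forall r, tb <= r <= t' -> 0 < u (g r) r].
Proof.
move=> tb0 tbt' u0; apply: contrapT => nog.
have noA x : ~ reached (x, tb).
  by move=> [_ [g [gC gt' _ g0]]]; apply: nog; exists g; split.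
have Ay : reached (y, t').
  split; first by rewrite /= lexx ltW.
  exists (cst y); split => //= [|r /andP[r1 r2]]; first by move=> ?; exact: cvg_cst.
  by have -> : r = t' by lra.
(* With this [e] the penalty over the whole strip costs half of [u y t']. So wherever [v] is at
   least its starting value, [u] is at least [u y t' / 2], hence positive, and [x] is bounded. *)
pose e := u y t' / (2 * (t' - tb)).
have tt0 : 0 < t' - tb by lra.
have e0 : 0 < e by rewrite divr_gt0 // mulr_gt0.
have eE : e * (t' - tb) = u y t' / 2 by rewrite /e; field; rewrite gt_eqF.
have u20 : 0 < u y t' / 2 by lra.
have [B [B0 uB]] := uV tb0 tbt' u20.
pose v (p : R * R) := u p.1 p.2 - e * p.2.
have inside x t : tb <= t <= t' -> v (y, t') <= v (x, t) -> `|x| < B.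
  move=> tI; rewrite /v /= => vv; rewrite ltNge; apply/negP => xB.
  have := uB _ _ tI xB; rewrite ltr_norml => /andP[_]; move: tI; nra.
(* Outside this compact part of the strip [v] is below its starting value, so a maximum over [K] is
   one over the closure within the strip. *)
pose K := closure reached `&` (`[- B, B] `*` `[tb, t']).
have Kin (p : R * R) : closure reached p -> `|p.1| <= B -> tb <= p.2 <= t' -> K p.
  move=> Ap pB pt; split => //; split => /=; last by rewrite in_itv.
  by rewrite in_itv /= -ler_norml.
have Ky : K (y, t').
  apply: Kin => //=; first exact: subset_closure.
    by apply/ltW/(inside y t'); rewrite ?lexx ?ltW.
  by rewrite lexx ltW.
have cK : compact K.
  rewrite /K setIC; apply: compact_closedI; last exact: closed_closure.
  by apply: compact_setX; exact: segment_compact.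
have vC : {within K, continuous v}.
  apply: continuous_in_subspaceT => p /set_mem [_ [_ /=]].
  rewrite in_itv /= => /andP[p2 _].
  apply: cvgB; first by case: p p2 => x t /= p2; apply: uC; lra.
  by apply: cvgM; [exact: cvg_cst|exact: cvg_snd].
have [c /set_mem Kc vmax] := compact_EVT_max (ex_intro _ _ Ky) cK vC.
case: Kc => Ac [_ /=]; rewrite in_itv /= => c2.
have vyc : v (y, t') <= v c by apply: vmax; rewrite inE.
have c1 : `|c.1| < B by apply: (inside _ c.2); rewrite -?surjective_pairing.
have uc : 0 < u c.1 c.2 by move: vyc c2; rewrite /v /=; nra.
have vA p : closure reached p -> tb <= p.2 <= t' -> v p <= v c.
  move=> Ap pI; have [vy|/ltW yv] := leP (v p) (v (y, t')).
    exact: le_trans vy vyc.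
  apply: vmax; rewrite inE; apply: Kin => //.
  by apply/ltW/(inside _ p.2); rewrite -?surjective_pairing.
have c20 : 0 < c.2 by lra.
have [d [d0 ud]] := half_plane_box c.1 c20 uc.
have box x t : `|x - c.1| < d -> `|t - c.2| < d -> 0 < u x t.
  by move=> xd td; have := ud x t xd td; rewrite ltr_norml => /andP[]; lra.
(* Some reached point lies within [h] of [c], hence above height [t]; from there a segment leads to
   [(x, t)]. *)
have below x t : `|x - c.1| < d -> c.2 - d < t -> tb <= t -> t < c.2 -> reached (x, t).
  move=> xd dt tbt tc.
  have ct : 0 < c.2 - t by lra.
  have [h [h0 hd hc]] := ex_pos_lt2 d0 ct.
  have [a [Aa a1 a2]] := closure_box Ac h0.
  apply: (reached_extend (c := c) (d := d) (p := a)) => //=.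
  - exact: lt_trans hd.
  - exact: lt_trans hd.
  - by rewrite ltr_norml; lra.
  - by move: a2; rewrite ltr_norml; lra.
(* A maximum at the bottom level is impossible: a reached point near [c] is already at height [tb],
   or else extends to [c] itself. *)
have [tbc|ctb] := ltP tb c.2; last first.
  have E : c.2 = tb by lra.
  have [a [Aa a1 a2]] := closure_box Ac d0.
  have [tba|atb] := ltP tb a.2; last first.
    have [/= aI _] := Aa.
    have E' : a.2 = tb by lra.
    by apply: (noA a.1); rewrite -E' -surjective_pairing.
  apply: (noA c.1); rewrite -E.
  apply: (reached_extend (c := c) (d := d) (p := a)) => //=.
  - by rewrite subrr normr0.
  - by rewrite subrr normr0.
  - by rewrite E.
  - by rewrite E.
have ct0 : 0 < c.2 - tb by lra.
have [h [h0 hd hc]] := ex_pos_lt2 d0 ct0.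
(* Near [c], lower points are reached and points at the same height are limits of reached ones, so
   [v <= v c] on the whole past half of a box. *)
apply: (@heat_no_backward_max R u c.1 c.2 h e) => //.
move=> x t xh ht tc; apply: (vA (x, t)) => /=; last by lra.
have [tlt|teq] := ltP t c.2.
  by apply: subset_closure; apply: below; lra.
have {teq}-> : t = c.2 by lra.
move=> N /nbhs_ballP[z /= z0 zN].
have [k [k0 kh kz]] := ex_pos_lt2 h0 z0.
exists (x, c.2 - k); split; first by apply: below; lra.
apply: zN; split; rewrite /ball /=; first by rewrite subrr normr0.
by rewrite opprB addrC subrK gtr0_norm.
Qed.

End descent.

Lemma heat_solutionN {R : realType} (u : R -> R -> R) :
  heat_solution u -> heat_solution (fun x t => - u x t).
Proof.
move=> [ux [uxx H]]; exists (fun x t => - ux x t), (fun x t => - uxx x t).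
move=> x t /(H x)[H1 H2 H3]; split; [exact: is_deriveN|exact: is_deriveN|].
by rewrite mulNr; exact: is_deriveN.
Qed.

Lemma descent {R : realType} (u : R -> R -> R) (tb t' y : R) :
  continuous_on_half_plane u -> heat_solution u -> vanishes_at_infinity u ->
  0 < tb -> tb < t' -> u y t' != 0 ->
  exists g : R -> R, [/\ continuous g, g t' = y &
    forall r, tb <= r <= t' -> u (g r) r != 0].
Proof.
move=> uC uH uV tb0 tbt'; rewrite neq_lt => /orP[u0|u0].
  have [||||||g [gC gy g0]] := @descent_pos _ (fun x t => - u x t) _ tb t' y.
  - by move=> x t t0; apply: cvgN; exact: uC.
  - exact: heat_solutionN.
  - move=> a b a0 ab e /(uV a b a0 ab)[B [B0 H]]; exists B; split => // x t.
    by rewrite normrN; exact: H.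
  - by [].
  - by [].
  - by rewrite oppr_gt0.
  exists g; split => // r /g0; rewrite oppr_gt0 => /lt_eqF ->.
  by [].
have [g [gC gy g0]] := descent_pos uC uH uV tb0 tbt' u0.
by exists g; split => // r /g0 /gt_eqF ->.
Qed.

(** * Level crossings and limits of continuous functions *)

Section real_curves.
Context {R : realType}.
Implicit Types (f tau : R -> R).

Lemma continuous_neq0_gt0 f (a b : R) : continuous f -> a <= b -> 0 < f a ->
  (forall s, a <= s <= b -> f s != 0) -> 0 < f b.
Proof.
move=> fC ab fa nz; rewrite ltNge; apply/negP => fb.
have [||c cI fc] := @IVT R f a b 0 ab.
- exact: continuous_subspaceT.
- by rewrite ge_min fb orbT le_max (ltW fa).
by move: cI; rewrite in_itv /= => /nz; rewrite fc eqxx.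
Qed.

(** The crossing is the largest parameter in [[a, b]] at which [tau] is at least [h]; it exists by
    compactness. *)
Lemma last_crossing tau (a b h : R) : continuous tau -> a <= b ->
  h <= tau a -> tau b < h ->
  exists s, [/\ a <= s, s < b, tau s = h & forall r, s <= r <= b -> tau r <= h].
Proof.
move=> tauC ab ha bh.
pose A := `[a, b]%classic `&` (tau @^-1` `[h, +oo[%classic).
have cA : compact A.
  apply: compact_closedI; first exact: segment_compact.
  by apply: preimage_closed => [x _|]; [exact: tauC|exact: rray_closed].
have Aa : A a by split => /=; rewrite in_itv /= ?lexx ?ab ?ha.
have [|c /set_mem[/=]] := @compact_EVT_max R R idfun A (ex_intro _ _ Aa) cA.
  by apply: continuous_subspaceT => x; exact: cvg_id.
rewrite !in_itv /= andbT => /andP[ac cb] hc cmax.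
have cb' : c < b.
  rewrite lt_neqAle cb andbT; apply/eqP => E; move: bh; rewrite -E; lra.
have beyond r : c < r -> r <= b -> tau r < h.
  move=> cr rb; rewrite ltNge; apply/negP => hr.
  have : r <= c; last lra.
  by apply: cmax; rewrite inE; split => /=; rewrite in_itv /= ?hr ?rb; lra.
have tc : tau c = h.
  have [||r rI Er] := @IVT R tau c b h cb.
  - exact: continuous_subspaceT.
  - by rewrite ge_min le_max hc (ltW bh) orbT.
  move: rI; rewrite in_itv /= => /andP[cr rb].
  have [cr'|rc] := ltP c r; first by have := beyond r cr' rb; lra.
  by have <- : r = c by lra.
exists c; split => // r /andP[cr rb].
have [cr'|rc] := ltP c r; first exact/ltW/beyond.
have -> : r = c by lra.
by rewrite tc.
Qed.

Lemma first_crossing tau (a b h : R) : continuous tau -> a <= b ->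
  tau a < h -> h <= tau b ->
  exists s, [/\ a < s, s <= b, tau s = h & forall r, a <= r <= s -> tau r <= h].
Proof.
move=> tauC ab ah hb.
have [||||s [s1 s2 s3 s4]] := @last_crossing (fun s => tau (- s)) (- b) (- a) h.
- by move=> s; apply: continuous_comp; [exact: opp_continuous|exact: tauC].
- by rewrite lerN2.
- by rewrite opprK.
- by rewrite opprK.
exists (- s); split => // [||r rI]; [by rewrite ltrNr|by rewrite lerNl|].
by rewrite -(opprK r); apply: s4; lra.
Qed.

Lemma cvg_pinftyP f (l : R) :
  (forall e, 0 < e -> exists S, forall s, S <= s -> `|f s - l| < e) ->
  f s @[s --> +oo] --> l.
Proof.
move=> H; apply/cvgrPdist_lt => e /H[S HS].
near=> s; rewrite distrC; apply: HS.
by near: s; apply: nbhs_pinfty_ge; exact: num_real.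
Unshelve. all: by end_near. Qed.

End real_curves.

(** * Curves of zeros that stay above a positive level *)

Section zero_curve.
Context {R : realType} (u : R -> R -> R).
Hypothesis uC : continuous_on_half_plane u.
Hypothesis uH : heat_solution u.
Hypothesis uV : vanishes_at_infinity u.
Hypothesis uN : forall t a b, 0 < t -> a < b -> exists y, a < y < b /\ u y t != 0.

Variables (chi tau : R -> R) (tb : R).
Hypothesis chiC : continuous chi.
Hypothesis tauC : continuous tau.
Hypothesis uZ : forall s, u (chi s) (tau s) = 0.
Hypothesis tb0 : 0 < tb.
Hypothesis tbtau : forall s, tb < tau s.
Hypothesis locally_injective : forall s0, exists d, 0 < d /\
  forall s s', `|s - s0| < d -> `|s' - s0| < d ->
    chi s = chi s' -> tau s = tau s' -> s = s'.

(* The path descending from a point between the two ends stays between them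
   for as long as it stays above the arc, so it would have to cross the arc. *)
Lemma same_height (a b : R) : a <= b -> tau a = tau b ->
  (forall s, a <= s <= b -> tau s <= tau a) -> chi a = chi b.
Proof.
move=> ab tab tmax; apply/eqP/negPn/negP => cab.
have [y [yI uy]] : exists y,
    Num.min (chi a) (chi b) < y < Num.max (chi a) (chi b) /\ u y (tau a) != 0.
  apply: uN; first exact: lt_trans tb0 _.
  by rewrite gt_min !lt_max !ltxx orbF -neq_lt.
have [g [gC gy g0]] := descent uC uH uV tb0 (tbtau a) uy.
have hC : continuous (fun s => chi s - g (tau s)).
  by move=> s; apply: cvgB; [exact: chiC|apply: continuous_comp; [exact: tauC|exact: gC]].
have [||c cI hc] := @IVT R (fun s => chi s - g (tau s)) a b 0 ab.
- exact: continuous_subspaceT.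
- rewrite -tab gy ge_min le_max !subr_le0 !subr_ge0.
  by move: yI; rewrite gt_min lt_max => /andP[/orP[] /ltW -> /orP[] /ltW ->];
    rewrite ?orbT.
move: cI; rewrite in_itv /= => cI.
have := g0 (tau c); rewrite tmax // (ltW (tbtau c)) => /(_ isT).
have -> : g (tau c) = chi c by move: hc => /=; lra.
by rewrite uZ eqxx.
Qed.

(** At a local minimum [tau] rises strictly on both sides, since an arc of constant height would
    have equal ends against local injectivity. Between the last crossing of a slightly higher level
    on the left and the first one on the right, the arc lies below its ends, which therefore
    coincide: again a contradiction. *)
Lemma no_local_min (s0 d : R) : 0 < d ->
  (forall s, `|s - s0| < d -> tau s0 <= tau s) -> False.
Proof.
move=> d0 tmin.
have [d' [d'0 inj]] := locally_injective s0.
have [k [k0 kd kd']] := ex_pos_lt2 d0 d'0.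
have [a [a1 a2 ta]] : exists a, [/\ s0 - k <= a, a < s0 & tau s0 < tau a].
  apply: contrapT => nota.
  have E s : s0 - k <= s <= s0 -> tau s = tau s0.
    move=> sI; have [ss0|] := ltP s s0; last first.
      by move=> ?; congr tau; lra.
    apply/eqP; rewrite eq_le tmin ?andbT; last by rewrite ltr_norml; lra.
    by rewrite leNgt; apply/negP => ?; apply: nota; exists s; split => //; lra.
  have := @same_height (s0 - k) s0 ltac:(lra).
  rewrite E; last lra.
  move=> /(_ erefl) /= H.
  have : s0 - k = s0; last lra.
  apply: inj; rewrite ?ltr_norml; [lra|lra| |].
    by apply: H => s sI; rewrite E.
  by rewrite E //; lra.
have [b [b1 b2 tb']] : exists b, [/\ s0 < b, b <= s0 + k & tau s0 < tau b].
  apply: contrapT => notb.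
  have E s : s0 <= s <= s0 + k -> tau s = tau s0.
    move=> sI; have [ss0|] := ltP s0 s; last first.
      by move=> ?; congr tau; lra.
    apply/eqP; rewrite eq_le tmin ?andbT; last by rewrite ltr_norml; lra.
    by rewrite leNgt; apply/negP => ?; apply: notb; exists s; split => //; lra.
  have := @same_height s0 (s0 + k) ltac:(lra).
  rewrite (E (s0 + k)); last lra.
  move=> /(_ erefl) /= H.
  have : s0 = s0 + k; last lra.
  apply: inj; rewrite ?ltr_norml; [lra|lra| |].
    by apply: H => s sI; rewrite E.
  by rewrite E //; lra.
have [h [h1 h2 h3]] : exists h, [/\ tau s0 < h, h <= tau a & h <= tau b].
  by have [?|?] := leP (tau a) (tau b); [exists (tau a)|exists (tau b)]; split; lra.
have [s [as_ ss0 ts sm]] := last_crossing tauC (ltW a2) h2 h1.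
have [r [sr rb tr rm]] := first_crossing tauC (ltW b1) h1 h3.
have : s = r; last lra.
apply: inj; rewrite ?ltr_norml; [lra|lra| |by rewrite ts].
apply: same_height; [lra|by rewrite ts|] => z /andP[sz zr].
rewrite ts; have [zs0|/ltW s0z] := leP z s0; [apply: sm|apply: rm]; lra.
Qed.

(** If [tau] rose again, its minimum over [[a, d]] would be attained in the interior: a minimum at
    [d] is also one at [c], and a minimum at [a] is excluded by [b]. *)
Lemma eventually_decreasing (a b c d : R) : a < b -> tau b < tau a ->
  b <= c -> c < d -> tau d < tau c.
Proof.
move=> ab tba bc cd; rewrite ltNge; apply/negP => tcd.
have [||m mI mmin] := @EVT_min R tau a d; first lra.
  exact: continuous_subspaceT.
have interior z : a < z < d -> tau z <= tau m -> False.
  move=> zI zm.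
  have [k [k0 k1 k2]] := @ex_pos_lt2 R (z - a) (d - z) ltac:(lra) ltac:(lra).
  apply: (@no_local_min z k k0) => s; rewrite ltr_norml => sI.
  by apply: le_trans zm _; apply: mmin; rewrite in_itv /=; lra.
move: mI; rewrite in_itv /= => mI.
have [md|dm] := ltP m d; last first.
  by apply: (interior c); [|have -> : m = d by lra]; lra.
have [am|ma] := ltP a m; first by apply: (interior m); lra.
by apply: (interior b); [|have -> : m = a by lra]; lra.
Qed.

(** Two paths descend from either side of [chi a] at height [tau a]. The curve starts between them
    and cannot meet them, and both are bounded on the compact range of heights. *)
Lemma descending_bounded (a : R) : (forall s, a <= s -> tau s <= tau a) ->
  exists B, forall s, a <= s -> `|chi s| <= B.
Proof.
move=> tmax; have ta0 : 0 < tau a by exact: lt_trans tb0 _.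
have [y [yI uy]] := @uN (tau a) (chi a) (chi a + 1) ta0 ltac:(lra).
have [z [zI uz]] := @uN (tau a) (chi a - 1) (chi a) ta0 ltac:(lra).
have [g [gC gy g0]] := descent uC uH uV tb0 (tbtau a) uy.
have [h [hC hz h0]] := descent uC uH uV tb0 (tbtau a) uz.
have [M _ gM] := EVT_max (ltW (tbtau a)) (continuous_subspaceT gC).
have [m _ hm] := EVT_min (ltW (tbtau a)) (continuous_subspaceT hC).
have gt s : {for s, continuous (fun s => g (tau s))}.
  by apply: continuous_comp; [exact: tauC|exact: gC].
have ht s : {for s, continuous (fun s => h (tau s))}.
  by apply: continuous_comp; [exact: tauC|exact: hC].
exists (Num.max (g M) (- h m)) => s sa.
have tI r : a <= r -> tb <= tau r <= tau a.
  by move=> ar; rewrite (ltW (tbtau r)) tmax.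
have up : 0 < g (tau s) - chi s.
  apply: (@continuous_neq0_gt0 R (fun s => g (tau s) - chi s) a s) => //.
  - by move=> r; apply: cvgB; [exact: gt|exact: chiC].
  - by rewrite gy; lra.
  - move=> r /andP[ar _]; apply/eqP => E; have := g0 (tau r) (tI r ar).
    by rewrite (_ : g (tau r) = chi r) ?uZ ?eqxx //; lra.
have lo : 0 < chi s - h (tau s).
  apply: (@continuous_neq0_gt0 R (fun s => chi s - h (tau s)) a s) => //.
  - by move=> r; apply: cvgB; [exact: chiC|exact: ht].
  - by rewrite hz; lra.
  - move=> r /andP[ar _]; apply/eqP => E; have := h0 (tau r) (tI r ar).
    by rewrite (_ : h (tau r) = chi r) ?uZ ?eqxx //; lra.
have gs : g (tau s) <= g M by apply: gM; rewrite in_itv /= tI.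
have hs : h m <= h (tau s) by apply: hm; rewrite in_itv /= tI.
rewrite ler_norml le_max lerNl le_max.
by apply/andP; split; apply/orP; [right|left]; lra.
Qed.

Lemma descending_end (a b : R) : a < b -> tau b < tau a ->
  exists x t : R, [/\ tb <= t, chi s @[s --> +oo] --> x & tau s @[s --> +oo] --> t].
Proof.
move=> ab tba.
have dec c d : b <= c -> c < d -> tau d < tau c.
  exact: eventually_decreasing ab tba.
have dec' c d : b <= c -> c <= d -> tau d <= tau c.
  by move=> bc; rewrite le_eqVlt => /predU1P[->//|/(dec _ _ bc)/ltW].
pose T := inf [set tau s | s in [set s | b <= s]].
have hT : has_inf [set tau s | s in [set s | b <= s]].
  split; first by exists (tau b), b => //=.
  by exists tb => _ [s _ <-]; exact: ltW.
have Tlb s : b <= s -> T <= tau s.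
  by move=> bs; apply: (ge_inf hT.2); exists s.
have tbT : tb <= T.
  apply: lb_le_inf; first exact: hT.1.
  by move=> _ [s _ <-]; exact: ltW.
have Tap e : 0 < e -> exists S, b <= S /\ forall s, S <= s -> tau s < T + e.
  move=> e0; have [_ [S bS <-] tS] := inf_adherent e0 hT.
  by exists S; split => // s Ss; apply: le_lt_trans tS; exact: dec'.
have T0 : 0 < T by exact: lt_le_trans tbT.
have [B chiB] := @descending_bounded b (fun s bs => dec' b s (lexx b) bs).
(* The eventual lower bounds of [chi]; [sup X] is its lower limit at infinity. *)
pose X := [set y | exists S, forall s, S <= s -> y <= chi s].
have XB y : X y -> y <= B.
  move=> [S HS]; have [?|?] := leP S b.
    by apply: le_trans (HS b _) _ => //; have := chiB b (lexx b); rewrite ler_norml => /andP[].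
  by apply: le_trans (HS S _) _ => //; have := chiB S (ltac:(lra)); rewrite ler_norml => /andP[].
have hX : has_sup X.
  split; last by exists B.
  by exists (- B), b => s bs; have := chiB s bs; rewrite ler_norml => /andP[].
exists (sup X), T; split => //; last first.
  apply: cvg_pinftyP => e /Tap[S [bS HS]]; exists S => s Ss.
  have := HS s Ss; have := Tlb s (le_trans bS Ss); rewrite ltr_norml; lra.
apply: cvg_pinftyP => e e0.
have [y [S1 HS1] Xy] := sup_adherent e0 hX.
(* A point slightly to the right of the lower limit where [u] is nonzero at the limiting height. No
   zero of [u] is near it, so from some parameter on the curve cannot cross the vertical line
   through [z]. *)
have [z [zI uz]] := @uN T (sup X) (sup X + e) T0 ltac:(lra).
have [|d [d0 ud]] := @half_plane_box R u uC z T `|u z T| T0; first by rewrite normr_gt0.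
have [S2 [bS2 HS2]] := Tap d d0.
have nz s : S2 <= s -> chi s - z != 0.
  move=> Ss; rewrite subr_eq0; apply/eqP => E.
  have zz : `|z - z| < d by rewrite subrr normr0.
  have tT : `|tau s - T| < d.
    have := HS2 s Ss; have := Tlb s (le_trans bS2 Ss); rewrite ltr_norml; lra.
  by have := ud z (tau s) zz tT; rewrite -{1}E uZ sub0r normrN ltxx.
have below s : S2 <= s -> chi s < z.
  move=> Ss; rewrite ltNge; apply/negP; rewrite le_eqVlt => /predU1P[E|zs].
    by have := nz s Ss; rewrite E subrr eqxx.
  (* Once to the right of [z] the curve would stay there, making [z] an eventual lower bound above
     [sup X]. *)
  have : X z; last first.
    by move=> /(ub_le_sup hX.2); lra.
  exists s => r sr; rewrite -subr_ge0; apply/ltW.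
  apply: (@continuous_neq0_gt0 R (fun s => chi s - z) s r) => //.
  - by move=> q; apply: cvgB; [exact: chiC|exact: cvg_cst].
  - by rewrite subr_gt0.
  - by move=> q /andP[sq _]; apply: nz; lra.
exists (Num.max S1 S2) => s; rewrite ge_max => /andP[/HS1 h1 /below h2].
by rewrite ltr_norml; lra.
Qed.

End zero_curve.

(** * Continuity of real-analytic functions *)

Section analytic.
Context {R : realType}.
Implicit Types (g h : R -> R).

Lemma sum_geometric_half (q : R) n : 0 <= q <= 2^-1 ->
  \sum_(0 <= i < n) q ^+ i <= 2.
Proof.
move=> /andP[q0 q1]; rewrite big_mkord -(@ler_pM2l _ (1 - q)); last lra.
rewrite -opprB mulNr -subrX1 opprB.
have : 0 <= q ^+ n by exact: exprn_ge0.
lra.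
Qed.

(** Convergence at one radius [r] bounds all [a n * r ^+ n] by some [M]. Comparison with a geometric
    series of ratio at most 1/2 then bounds the distance from [g (s0 + z)] to [a 0%N] by a multiple
    of the absolute value of [z]. *)
Lemma real_analytic_at_continuous g (s0 : R) :
  real_analytic_at g s0 -> {for s0, continuous g}.
Proof.
move=> [a /nbhs_ballP[d /= d0 ad]].
pose r := d / 2.
have r0 : 0 < r by rewrite /r; lra.
have cvr : cvgn (pseries a r).
  apply/cvg_ex; exists (g (s0 + r)).
  have := ad (s0 + r); rewrite addrAC subrr add0r; apply.
  by rewrite /ball /= opprD addNKr normrN gtr0_norm // /r; lra.
have [K [Kr Kb]] := cvg_series_bounded cvr.
pose M := `|K| + 1.
have M0 : 0 < M by rewrite /M; have := normr_ge0 K; lra.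
have aM n : `|a n * r ^+ n| <= M.
  by apply: Kb => //; rewrite /M (le_lt_trans (ler_norm K)) // ltrDl.
have bound z : `|z| <= r / 2 -> `|g (s0 + z) - a 0%N| <= 2 * M / r * `|z|.
  move=> zr.
  have zd : ball s0 d (s0 + z).
    by rewrite /ball /= opprD addNKr normrN (le_lt_trans zr) // /r; lra.
  have := ad _ zd; rewrite addrAC subrr add0r => cz.
  have cz' : pseries a z n.+1 @[n --> \oo] --> g (s0 + z) by rewrite cvg_shiftS.
  have : `|pseries a z n.+1 - a 0%N| @[n --> \oo] --> `|g (s0 + z) - a 0%N|.
    by apply: cvg_norm; apply: cvgB => //; exact: cvg_cst.
  move/cvg_lim => /(_ (@Rhausdorff R)) <-.
  apply: limr_le.
    apply: is_cvg_norm; apply: is_cvgB; last exact: is_cvg_cst.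
    by apply/cvg_ex; exists (g (s0 + z)).
  apply: nearW => n.
  rewrite /pseries /series /= big_nat_recl // expr0 mulr1 addrAC subrr add0r.
  apply: (le_trans (ler_norm_sum _ _ _)).
  pose q := `|z| / r.
  have q0 : 0 <= q <= 2^-1.
    by rewrite divr_ge0 ?(ltW r0) //= ler_pdivrMr // mulrC.
  apply: (@le_trans _ _ (\sum_(0 <= i < n) M * q * q ^+ i)).
    apply: ler_sum => i _; rewrite -mulrA -exprS.
    rewrite /q expr_div_n mulrA ler_pdivlMr ?exprn_gt0 //.
    have := aM i.+1; rewrite !normrM !normrX (gtr0_norm r0) => aMi.
    by rewrite mulrAC ler_wpM2r // exprn_ge0.
  rewrite -mulr_sumr.
  have := sum_geometric_half n q0.
  have Mq : 0 <= M * q by rewrite mulr_ge0 ?(ltW M0) //; case/andP: q0.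
  move=> /(ler_wpM2l Mq) /le_trans; apply.
  by rewrite /q; lra.
have g0 : g s0 = a 0%N.
  have := bound 0; rewrite normr0 mulr0 addr0 => /(_ ltac:(lra)).
  by rewrite normr_le0 subr_eq0 => /eqP.
apply/cvgrPdist_lt => e e0.
have Mr0 : 0 < 2 * M / r by rewrite divr_gt0 // mulr_gt0.
have [k [k0 kr ke]] := @ex_pos_lt2 R (r / 2) (e / (2 * M / r)) ltac:(lra) (divr_gt0 e0 Mr0).
apply/nbhs_ballP; exists k => //= s; rewrite /ball /= distrC => sk.
have := bound (s - s0) (ltW (lt_trans sk kr)).
rewrite subrKC g0 distrC => /le_lt_trans; apply.
by rewrite mulrC -ltr_pdivlMr // (lt_trans sk).
Qed.

Lemma continuous_translate g h (s0 : R) : {for 0, continuous g} ->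
  (\forall s \near (0 : R), h (s0 + s) = g s) -> {for s0, continuous h}.
Proof.
move=> gC /nbhs_ballP[d /= d0 hg].
have hs0 : h s0 = g 0 by rewrite -(hg 0) ?addr0 //; exact: ballxx.
apply/cvgrPdist_lt => e e0.
have /cvgrPdist_lt /(_ e e0) /nbhs_ballP[d' /= d'0 gd] := gC.
have [k [k0 kd kd']] := ex_pos_lt2 d0 d'0.
apply/nbhs_ballP; exists k => //= s; rewrite /ball /= distrC => sk.
have E : h s = g (s - s0).
  rewrite -(hg (s - s0)) ?subrKC //.
  by rewrite /ball /= sub0r normrN (lt_trans sk).
rewrite hs0 E; apply: gd.
by rewrite /ball /= sub0r normrN (lt_trans sk).
Qed.

End analytic.

(** * Contours reach every lower positive level *)

Section contour.
Context {R : realType} (u : R -> R -> R).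
Hypothesis uC : continuous_on_half_plane u.
Hypothesis uH : heat_solution u.
Hypothesis uV : vanishes_at_infinity u.
Hypothesis uN : forall t a b, 0 < t -> a < b -> exists y, a < y < b /\ u y t != 0.

Lemma continues_branches_continuous (Z : set (R * R)) c :
  continues_branches Z c ->
  continuous (fun s => (c s).1) /\ continuous (fun s => (c s).2).
Proof.
move=> H; split=> s0; have [W [k [eps [br [[_ Hj _ _] [j cj]]]]]] := H s0;
  have [e0 an _ _ _] := Hj j;
  (have [a1 a2] : real_analytic_curve_at (br j) 0
     by apply: an => /=; rewrite in_itv /= oppr_lt0 e0);
  [apply: continuous_translate (real_analytic_at_continuous a1) _|
   apply: continuous_translate (real_analytic_at_continuous a2) _];
  by apply: filterS cj => s ->.
Qed.

Lemma continues_branches_injective (Z : set (R * R)) c (s0 : R) :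
  continues_branches Z c -> exists d, 0 < d /\
    forall s s', `|s - s0| < d -> `|s' - s0| < d -> c s = c s' -> s = s'.
Proof.
move=> /(_ s0)[W [k [eps [br [[_ Hj _ _] [j /nbhs_ballP[d /= d0 cj]]]]]]].
have [e0 _ inj _ _] := Hj j.
have [h [h0 hd he]] := ex_pos_lt2 d0 e0.
exists h; split => // s s' sh s'h css'.
have E z : `|z - s0| < h -> c z = br j (z - s0).
  move=> zh; rewrite -(cj (z - s0)) ?subrKC //.
  by rewrite /ball /= sub0r normrN (lt_trans zh).
have I z : `|z - s0| < h -> z - s0 \in `]- eps j, eps j[%classic.
  by move=> /lt_trans /(_ he); rewrite ltr_norml inE /= in_itv.
apply: (addIr (- s0)); apply: inj; [exact: I|exact: I|].
by rewrite -!E.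
Qed.

Lemma contour_curve_descends (C : set (R * R)) (t1 t2 : R) :
  contour_curve [set p | upper_half_plane p /\ u p.1 p.2 = 0] C ->
  0 < t1 -> t1 < t2 ->
  C `&` horizontal_line t2 !=set0 -> C `&` horizontal_line t1 !=set0.
Proof.
set Z := [set _ | _].
move=> [c [-> cZ cE]] t10 t12 [_ [[s2 _ <-] /= cs2]].
apply: contrapT => nomeet.
have [chiC tauC] := continues_branches_continuous cZ.
have cIn s : Z (c s).
  have [W [k [eps [br [[[pW _] Hj _ U] [j cj]]]]]] := cZ s.
  have [e0 _ _ br0 _] := Hj j.
  have : (Z `&` W) (c s); last by case.
  rewrite -U; exists j => //; exists 0 => //=.
  by rewrite in_itv /= oppr_lt0 e0.
have tau_neq s : (c s).2 != t1.
  by apply/eqP => E; apply: nomeet; exists (c s); split => //; exists s.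
(* The height is [t2] at [s2] and never [t1], so by continuity it exceeds [t1] on both sides of
   [s2]. *)
have tau_gt s : t1 < (c s).2.
  rewrite -subr_gt0.
  have tC : continuous (fun s => (c s).2 - t1).
    by move=> z; apply: cvgB; [exact: tauC|exact: cvg_cst].
  have p2 : 0 < (c s2).2 - t1 by rewrite cs2 subr_gt0.
  have [ss|ss] := leP s2 s.
    by apply: (continuous_neq0_gt0 tC ss p2) => r _; rewrite subr_eq0.
  rewrite -[s]opprK.
  apply: (@continuous_neq0_gt0 R (fun s => (c (- s)).2 - t1) (- s2) (- s)).
  - move=> z; apply: (@continuous_comp _ _ _ -%R (fun s => (c s).2 - t1)).
      exact: opp_continuous.
    exact: tC.
  - by rewrite lerN2 ltW.
  - by rewrite opprK.
  - by move=> r _; rewrite subr_eq0.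
have uZ s : u (c s).1 (c s).2 = 0 by case: (cIn s).
have inj s0 : exists d, 0 < d /\ forall s s', `|s - s0| < d -> `|s' - s0| < d ->
    (c s).1 = (c s').1 -> (c s).2 = (c s').2 -> s = s'.
  have [d [d0 di]] := continues_branches_injective s0 cZ.
  exists d; split => // s s' sd s'd E1 E2; apply: di => //.
  by rewrite (surjective_pairing (c s)) E1 E2 -surjective_pairing.
(* Otherwise [s2] would be a minimum of the height. *)
have [s ss] : exists s, (c s).2 < (c s2).2.
  apply: contrapT => nos.
  apply: (no_local_min uC uH uV uN chiC tauC uZ t10 tau_gt inj (s0 := s2) ltr01) => s _.
  by rewrite leNgt; apply/negP => ?; apply: nos; exists s.
have noend x t : t1 <= t -> endpoint c (x, t) -> False.
  by move=> t1t /cE /=; lra.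
have [s2s|] := ltP s2 s.
  have [x [t [t1t cx ct]]] := descending_end uC uH uV uN chiC tauC uZ t10 tau_gt inj s2s ss.
  apply: (noend x t t1t); left.
  rewrite (_ : c = fun s => ((c s).1, (c s).2)); first exact: (cvg_pair cx ct).
  by apply/funext => z; rewrite -surjective_pairing.
rewrite le_eqVlt => /predU1P[E|s_s2]; first by move: ss; rewrite E ltxx.
(* If the lower point comes before [s2], the reversed curve descends, and its limit is an end of [c]
   at minus infinity. *)
have rC (h : R -> R) : continuous h -> continuous (fun s => h (- s)).
  move=> hC z; apply: (@continuous_comp _ _ _ -%R h); first exact: opp_continuous.
  exact: hC.
have [|||||x [t [t1t cx ct]]] := @descending_end R u uC uH uV uN
    (fun s => (c (- s)).1) (fun s => (c (- s)).2) t1 (rC _ chiC) (rC _ tauC)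
    _ t10 _ _ (- s2) (- s).
- by move=> z; exact: uZ.
- by move=> z; exact: tau_gt.
- move=> s0; have [d [d0 di]] := inj (- s0).
  exists d; split => // z z' zd z'd E1 E2; apply: oppr_inj; apply: di => //.
    by rewrite -opprD normrN.
  by rewrite -opprD normrN.
- by rewrite ltrN2.
- by rewrite !opprK.
apply: (noend x t t1t); right.
have F (h : R -> R) (l : R) : h (- s) @[s --> +oo] --> l -> h s @[s --> -oo] --> l.
  move=> H; rewrite (_ : h = (fun s => h (- s)) \o -%R); last first.
    by apply/funext => z; rewrite /= opprK.
  apply: (@cvg_comp _ _ _ -%R (fun s => h (- s)) _ _ _ _ H).
  by move=> P; rewrite ninftyN.
rewrite (_ : c = fun s => ((c s).1, (c s).2)); last first.
  by apply/funext => z; rewrite -surjective_pairing.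
exact: (cvg_pair (F _ _ cx) (F _ _ ct)).
Qed.

End contour.

(** * Integration of bounded functions against [f] *)

Section pairing.
Context {R : realType} (f : R -> R).
Hypothesis fI : (@lebesgue_measure R).-integrable setT (EFin \o f).

Definition bounded_measurable (g : R -> R) : Prop :=
  measurable_fun setT g /\ exists M, forall y, `|g y| <= M.

Definition pairing (g : R -> R) : R := \int[@lebesgue_measure R]_y (f y * g y).

Definition norm1 : R := \int[@lebesgue_measure R]_y `|f y|.

Lemma bounded_measurableD g h : bounded_measurable g -> bounded_measurable h ->
  bounded_measurable (fun y => g y + h y).
Proof.
move=> [mg [M gM]] [mh [N hN]]; split; first exact: measurable_funD.
by exists (M + N) => y; apply: le_trans (ler_normD _ _) _; exact: lerD.
Qed.

Lemma bounded_measurableZ c g : bounded_measurable g ->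
  bounded_measurable (fun y => c * g y).
Proof.
move=> [mg [M gM]]; split; first by apply: measurable_funM => //; exact: measurable_cst.
by exists (`|c| * M) => y; rewrite normrM ler_wpM2l.
Qed.

Lemma pairing_integrable g : bounded_measurable g ->
  (@lebesgue_measure R).-integrable setT (EFin \o (fun y => f y * g y)).
Proof.
move=> [mg [M gM]].
have := @integrableMl _ _ R lebesgue_measure setT measurableT (EFin \o f) g fI mg.
rewrite (_ : (_ \* _)%E = EFin \o (fun y => f y * g y)); last first.
  by apply/funext => y /=; rewrite EFinM.
apply; exists M; split; first exact: num_real.
by move=> N MN y _ /=; apply: le_trans (gM y) (ltW MN).
Qed.

Lemma scaled_norm_integrable M :
  (@lebesgue_measure R).-integrable setT (EFin \o (fun y => M * `|f y|)).
Proof.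
rewrite (_ : _ \o _ = (fun y => M%:E * (EFin \o (fun y => `|f y|%R)) y)%E).
  by apply: integrableZl => //; exact: (integrable_norm fI).
by apply/funext => y /=; rewrite EFinM.
Qed.

Lemma pairing_le g M : bounded_measurable g -> (forall y, `|g y| <= M) ->
  `|pairing g| <= M * norm1.
Proof.
move=> bg gM; have ig := pairing_integrable bg.
apply: le_trans (le_normr_Rintegral measurableT ig) _.
have ifn : (@lebesgue_measure R).-integrable setT (EFin \o (fun y => `|f y|)).
  exact: (integrable_norm fI).
rewrite /norm1 -RintegralZl //; apply: le_Rintegral => //.
- exact: (integrable_norm ig).
- exact: scaled_norm_integrable.
- by move=> y _; rewrite normrM mulrC ler_wpM2r.
Qed.

Lemma pairingD g h : bounded_measurable g -> bounded_measurable h ->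
  pairing (fun y => g y + h y) = pairing g + pairing h.
Proof.
move=> bg bh; rewrite /pairing -RintegralD //; [|exact: pairing_integrable..].
by apply: eq_Rintegral => y _; rewrite mulrDr.
Qed.

Lemma pairingZ c g : bounded_measurable g ->
  pairing (fun y => c * g y) = c * pairing g.
Proof.
move=> bg; rewrite /pairing -RintegralZl //; last exact: pairing_integrable.
by apply: eq_Rintegral => y _; rewrite mulrCA.
Qed.

Lemma bounded_measurable0 : bounded_measurable (fun=> 0).
Proof.
by split; [exact: measurable_cst|exists 0 => y; rewrite normr0].
Qed.

Lemma pairing0 : pairing (fun=> 0) = 0.
Proof. by have := pairingZ 0 bounded_measurable0; rewrite !mul0r. Qed.

Lemma bounded_measurable_sum (g : nat -> R -> R) n :
  (forall i, bounded_measurable (g i)) ->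
  bounded_measurable (fun y => \sum_(0 <= i < n) g i y).
Proof.
move=> bg; elim: n => [|n IHn].
  rewrite (_ : (fun _ => _) = fun=> 0); first exact: bounded_measurable0.
  by apply/funext => y; rewrite big_nil.
rewrite (_ : (fun _ => _) = fun y => \sum_(0 <= i < n) g i y + g n y).
  exact: bounded_measurableD.
by apply/funext => y; rewrite big_nat_recr.
Qed.

Lemma pairing_sum (g : nat -> R -> R) n :
  (forall i, bounded_measurable (g i)) ->
  pairing (fun y => \sum_(0 <= i < n) g i y) = \sum_(0 <= i < n) pairing (g i).
Proof.
move=> bg; elim: n => [|n IHn].
  rewrite big_nil -[RHS]pairing0; congr pairing.
  by apply/funext => y; rewrite big_nil.
rewrite big_nat_recr //= -IHn -pairingD //; last exact: bounded_measurable_sum.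
by congr pairing; apply/funext => y; rewrite big_nat_recr.
Qed.

(** Dominated convergence with the integrable bound [M * |f|]. *)
Lemma pairing_cvg (g_ : nat -> R -> R) (g : R -> R) (M : R) :
  (forall n, measurable_fun setT (g_ n)) -> (forall n y, `|g_ n y| <= M) ->
  (forall y, g_ n y @[n --> \oo] --> g y) ->
  bounded_measurable g /\ pairing (g_ n) @[n --> \oo] --> pairing g.
Proof.
move=> mg gM gg.
have bg_ n : bounded_measurable (g_ n) by split => //; exists M.
have bg : bounded_measurable g.
  split; first exact: (measurable_fun_cvg _ (fun y _ => gg y)).
  exists M => y; have /cvg_norm := gg y => /cvg_lim <- //.
  apply: limr_le; last exact: nearW.
  by apply/cvg_ex; exists `|g y|; apply: cvg_norm; exact: gg.
split => //; have /integrableP[/measurable_EFinP mf _] := fI.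
have ifM := scaled_norm_integrable M.
have [||||| ig _ cg] := @dominated_convergence _ _ R lebesgue_measure setT measurableT
  (fun n y => (f y * g_ n y)%:E) (fun y => (f y * g y)%:E)
  (EFin \o (fun y => M * `|f y|)).
- move=> n; apply/measurable_EFinP; apply: measurable_funM; [exact: mf|exact: mg].
- apply/measurable_EFinP; apply: measurable_funM; [exact: mf|exact: bg.1].
- apply/aeW => y _; apply: cvg_EFin; first exact: nearW.
  by apply: cvgM; [exact: cvg_cst|exact: gg].
- exact: ifM.
- apply/aeW => y n _; rewrite lee_fin normrM mulrC.
  by rewrite ler_wpM2r.
apply: (@fine_cvg _ _ _ _ (fun n => \int[lebesgue_measure]_y (f y * g_ n y)%:E)%E).
rewrite /= in cg; rewrite /pairing /Rintegral fineK //.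
exact: integrable_fin_num.
Qed.

Lemma is_derive_pairing (k k' : R -> R -> R) (a d M : R) : 0 < d ->
  (forall x y, `|x - a| < d -> is_derive x 1 (k^~ y) (k' x y)) ->
  (forall x, `|x - a| < d -> bounded_measurable (k x)) ->
  (forall x y, `|x - a| < d -> `|k' x y| <= M) ->
  is_derive a 1 (fun x => pairing (k x)) (pairing (k' a)).
Proof.
move=> d0 dk bk k'M.
have Id x : (`]a - d, a + d[%classic : set R) x -> `|x - a| < d.
  by rewrite /= in_itv /= ltr_distl.
have Ia : (`]a - d, a + d[%classic : set R) a by rewrite /= in_itv /=; lra.
have dfk x y : `|x - a| < d -> is_derive x 1 (fun x => f y * k x y) (f y * k' x y).
  move=> xd; have := dk x y xd => dkx.
  by apply: is_deriveZ.
have p1 x y : `|x - a| < d -> partial1of2 (fun x y => f y * k x y) x y = f y * k' x y.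
  by move=> xd; rewrite partial1of2E; have [_ ->] := dfk x y xd.
have intf x : (`]a - d, a + d[%classic : set R) x ->
    (@lebesgue_measure R).-integrable setT (EFin \o (fun y => f y * k x y)).
  by move=> /Id /bk; exact: pairing_integrable.
have der x y : (`]a - d, a + d[%classic : set R) x -> setT y ->
    derivable (fun x => f y * k x y) x 1.
  by move=> /Id xd _; have [] := dfk x y xd.
have G0 y : 0 <= `|M| * `|f y| by rewrite mulr_ge0.
have ifM := scaled_norm_integrable `|M|.
have ub x y : (`]a - d, a + d[%classic : set R) x -> setT y ->
    `|partial1of2 (fun x y => f y * k x y) x y| <= `|M| * `|f y|.
  move=> /Id xd _; rewrite p1 // normrM mulrC ler_wpM2r //.
  by apply: le_trans (k'M _ _ xd) _; exact: ler_norm.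
have E : pairing (k' a) =
    \int[lebesgue_measure]_(y in setT) partial1of2 (fun x y => f y * k x y) a y.
  by apply: eq_Rintegral => y _; rewrite p1 ?subrr ?normr0.
split; first exact: (derivable_under_integral measurableT Ia intf der G0 ifM ub).
rewrite -derive1E E.
exact: (differentiation_under_integral measurableT Ia intf der G0 ifM ub).
Qed.

End pairing.

(** * Gaussian moments of [f]: derivatives, bounds and decay *)

Section gaussian_moments.
Context {R : realType}.

Definition gauss_mono (n : nat) (b z : R) : R := z ^+ n * expR (- (b * z ^+ 2)).

Lemma pow_le_exp (w : R) n : 0 <= w -> w ^+ n <= n`!%:R * expR w.
Proof.
move=> w0; case: n => [|n].
  by rewrite expr0 fact0 mul1r -expR0 ler_expR.
rewrite -ler_pdivrMl ?ltr0n ?fact_gt0 // mulrC.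
by have := expR_ge1Dxn n w0; lra.
Qed.

(** With [w = b0 * z ^+ 2], this follows from [|z| ^+ n <= 1 + (z ^+ 2) ^+ n] and
    [w ^+ n <= n! * expR w]. The bound is uniform in [z] and in the rates above [b0], which is what
    domination requires. *)
Lemma gauss_mono_le n (b0 b z : R) : 0 < b0 -> b0 <= b ->
  `|gauss_mono n b z| <= 1 + n`!%:R / b0 ^+ n.
Proof.
move=> b00 b0b; rewrite /gauss_mono normrM (ger0_norm (expR_ge0 _)) normrX.
pose w := b0 * z ^+ 2.
have w0 : 0 <= w by rewrite mulr_ge0 ?sqr_ge0 ?(ltW b00).
have bw : expR (- (b * z ^+ 2)) <= expR (- w).
  by rewrite ler_expR lerN2 ler_wpM2r // sqr_ge0.
apply: (le_trans (ler_wpM2l _ bw)); first exact: exprn_ge0.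
have e1 : expR (- w) <= 1 by rewrite -expR0 ler_expR oppr_le0.
have e0 := expR_ge0 (- w).
have zn : `|z| ^+ n <= 1 + (z ^+ 2) ^+ n.
  rewrite -real_normK ?num_real // -exprM mulnC exprM.
  set q := `|z| ^+ n; have : 0 <= (q - 1) ^+ 2 by exact: sqr_ge0.
  by have : 0 <= q by [exact: exprn_ge0]; nra.
apply: (le_trans (ler_wpM2r e0 zn)).
rewrite mulrDl mul1r lerD // ler_pdivlMr ?exprn_gt0 //.
rewrite mulrAC -exprMn (mulrC _ b0) -/w.
rewrite expRN ler_pdivrMr ?expR_gt0 //; exact: pow_le_exp.
Qed.

(** For [n = 0] the index [n.-1] is again 0, but its coefficient vanishes. *)
Lemma is_derive_gauss_mono n (b z : R) : is_derive z 1 (gauss_mono n b)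
  (n%:R * gauss_mono n.-1 b z - 2 * b * gauss_mono n.+1 b z).
Proof.
have H1 : is_derive z 1 (fun z : R => z ^+ n) (n%:R * z ^+ n.-1).
  by apply: DeriveDef; [exact: exprn_derivable|rewrite exp_derive [_ *: 1]mulr1].
have H2 : is_derive z 1 (fun z : R => - (b * z ^+ 2)) (- (2 * b * z)).
  by apply: is_derive_eq; rewrite /GRing.scale /=; ring.
have H3 : is_derive z 1 (fun z : R => expR (- (b * z ^+ 2)))
    (expR (- (b * z ^+ 2)) * - (2 * b * z)).
  by apply: (@is_derive1_comp R expR (fun z : R => - (b * z ^+ 2))).
have := is_deriveM H1 H3; rewrite /gauss_mono => H.
apply: (is_derive_eq H).
rewrite /GRing.scale /= (exprS z n); ring.
Qed.

Lemma is_derive_gauss_mono_rate n (b z : R) :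
  is_derive b 1 (fun b => gauss_mono n b z) (- gauss_mono n.+2 b z).
Proof.
have H2 : is_derive b 1 (fun b : R => - (b * z ^+ 2)) (- z ^+ 2).
  by apply: is_derive_eq; rewrite /GRing.scale /=; ring.
have H3 : is_derive b 1 (fun b : R => expR (- (b * z ^+ 2)))
    (expR (- (b * z ^+ 2)) * - z ^+ 2).
  by apply: (@is_derive1_comp R expR (fun b : R => - (b * z ^+ 2))).
have := @is_deriveZ _ _ _ _ (z ^+ n) _ _ _ H3; rewrite /gauss_mono => H.
apply: (is_derive_eq H).
rewrite /GRing.scale /= !exprS; ring.
Qed.

Variable f : R -> R.
Hypothesis fI : (@lebesgue_measure R).-integrable setT (EFin \o f).

Lemma gauss_mono_bounded_measurable n (b x : R) : 0 < b ->
  bounded_measurable (fun y => gauss_mono n b (x - y)).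
Proof.
move=> b0; split; last first.
  by exists (1 + n`!%:R / b ^+ n) => y; exact: gauss_mono_le.
have C : continuous (fun y => gauss_mono n b (x - y)).
  move=> y; apply: (@continuous_comp _ _ _ (fun y => x - y) (gauss_mono n b)).
    by apply: cvgB; [exact: cvg_cst|exact: cvg_id].
  exact: is_derive1_continuous (is_derive_gauss_mono n b (x - y)).
exact: continuous_measurable_fun.
Qed.

Definition moment (n : nat) (x b : R) : R :=
  pairing f (fun y => gauss_mono n b (x - y)).

Lemma is_derive_moment n (x b : R) : 0 < b -> is_derive x 1 (moment n ^~ b)
  (n%:R * moment n.-1 x b - 2 * b * moment n.+1 x b).
Proof.
move=> b0.
have B m z := gauss_mono_bounded_measurable m z b0.
have := @is_derive_pairing R f fI (fun x y => gauss_mono n b (x - y))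
  (fun x y => n%:R * gauss_mono n.-1 b (x - y) - 2 * b * gauss_mono n.+1 b (x - y))
  x 1 (n%:R * (1 + n.-1`!%:R / b ^+ n.-1) + 2 * b * (1 + n.+1`!%:R / b ^+ n.+1)) ltr01.
move=> /(_ _ _ _)H.
rewrite (_ : _ - _ = pairing f (fun y =>
  n%:R * gauss_mono n.-1 b (x - y) - 2 * b * gauss_mono n.+1 b (x - y))); last first.
  have -> : (fun y => n%:R * gauss_mono n.-1 b (x - y) - 2 * b * gauss_mono n.+1 b (x - y))
    = (fun y => n%:R * gauss_mono n.-1 b (x - y) + (- (2 * b)) * gauss_mono n.+1 b (x - y)).
    by apply/funext => y; rewrite mulNr.
  rewrite (pairingD fI) ?(pairingZ fI) //; [|exact: bounded_measurableZ..].
  by rewrite mulNr.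
apply: H.
- move=> z y _.
  have H1 : is_derive z 1 (fun z : R => z - y) 1.
    by apply: is_derive_eq; rewrite subr0.
  have := @is_derive1_comp R (gauss_mono n b) (fun z : R => z - y) z _ _
    (is_derive_gauss_mono n b (z - y)) H1.
  by rewrite mulr1.
- by move=> z _; exact: B.
- move=> z y _; apply: (le_trans (ler_normB _ _)); apply: lerD.
    by rewrite normrM normr_nat ler_wpM2l // gauss_mono_le.
  rewrite normrM ger0_norm; last by rewrite mulr_ge0 // ltW.
  by rewrite ler_wpM2l ?gauss_mono_le // mulr_ge0 // ltW.
Qed.

Lemma is_derive_moment_rate n (x b : R) : 0 < b ->
  is_derive b 1 (moment n x) (- moment n.+2 x b).
Proof.
move=> b0; have b20 : 0 < b / 2 by lra.
(* The radius [b / 2] keeps the rates above [b / 2], where one bound serves for all of them. *)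
have := @is_derive_pairing R f fI (fun b y => gauss_mono n b (x - y))
  (fun b y => - gauss_mono n.+2 b (x - y)) b (b / 2)
  (1 + n.+2`!%:R / (b / 2) ^+ n.+2) b20.
have -> : pairing f (fun y => - gauss_mono n.+2 b (x - y)) = - moment n.+2 x b.
  rewrite -mulN1r -(pairingZ fI); last exact: gauss_mono_bounded_measurable.
  by congr pairing; apply/funext => y; rewrite mulN1r.
apply.
- by move=> c y _; exact: is_derive_gauss_mono_rate.
- by move=> c cb; apply: gauss_mono_bounded_measurable; move: cb; rewrite ltr_norml; lra.
- move=> c y cb; rewrite normrN; apply: gauss_mono_le => //.
  by move: cb; rewrite ltr_norml; lra.
Qed.

Lemma moment_le n (x b0 b : R) : 0 < b0 -> b0 <= b ->
  `|moment n x b| <= (1 + n`!%:R / b0 ^+ n) * norm1 f.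
Proof.
move=> b00 b0b; apply: pairing_le => //.
  by apply: gauss_mono_bounded_measurable; exact: lt_le_trans b0b.
by move=> y; exact: gauss_mono_le.
Qed.

(** Otherwise there are points going to infinity, with rates at least [b0], where the moment is at
    least [e] in absolute value. The integrands are uniformly bounded and tend to 0 pointwise, so
    dominated convergence gives a contradiction. *)
Lemma moment_vanishes n (b0 e : R) : 0 < b0 -> 0 < e -> exists B, 0 < B /\
  forall x b, b0 <= b -> B <= `|x| -> `|moment n x b| < e.
Proof.
move=> b00 e0; apply: contrapT => noB.
have far (k : nat) : exists p : R * R, [/\ b0 <= p.2, k%:R < `|p.1| & e <= `|moment n p.1 p.2|].
  apply: contrapT => nop; apply: noB; exists k.+1%:R; split => // x b bb kx.
  rewrite ltNge; apply/negP => ex; apply: nop; exists (x, b); split => //=.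
  by apply: lt_le_trans kx; rewrite ltr_nat.
have [p pP] := choice far.
pose C := 1 + n.+1`!%:R / b0 ^+ n.+1.
have C0 : 0 < C by rewrite /C ltr_pwDl // divr_ge0 // exprn_ge0 // ltW.
have bp k : b0 <= (p k).2 by case: (pP k).
(* The bound [C] for exponent [n.+1] gives decay of exponent [n] at rate [C] over the distance. *)
have cv y : gauss_mono n (p k).2 ((p k).1 - y) @[k --> \oo] --> 0.
  apply/cvgrPdist_lt => d d0.
  near=> k.
  rewrite sub0r normrN.
  have [_ kp _] := pP k.
  have ky : `|y| + C / d < k%:R by near: k; exact: nbhs_infty_gtr.
  have Cd : 0 < C / d by rewrite divr_gt0.
  have zC : C / d < `|(p k).1 - y|.
    by have := lerB_dist (p k).1 y; lra.
  have z0 : 0 < `|(p k).1 - y| by lra.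
  rewrite -(ltr_pM2l z0).
  have := @gauss_mono_le n.+1 b0 (p k).2 ((p k).1 - y) b00 (bp k).
  rewrite /gauss_mono exprS -mulrA normrM => /le_lt_trans; apply.
  by rewrite -ltr_pdivrMr.
have [||_ cvp] := @pairing_cvg R f fI
  (fun k y => gauss_mono n (p k).2 ((p k).1 - y)) (fun=> 0) (1 + n`!%:R / b0 ^+ n) _ _ cv.
- move=> k; apply: (gauss_mono_bounded_measurable _ _ _).1.
  exact: lt_le_trans (bp k).
- by move=> k y; exact: gauss_mono_le.
move: cvp; rewrite (pairing0 fI) => /cvgrPdist_lt /(_ e e0) [N _ /(_ N (leqnn N))].
rewrite sub0r normrN; have [_ _] := pP N.
by rewrite leNgt => /negP.
Unshelve. all: by end_near. Qed.

End gaussian_moments.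

(** * The second derivative of the heat evolution in terms of moments *)

Section heat_kernel.
Context {R : realType} (f : R -> R).
Hypothesis fI : (@lebesgue_measure R).-integrable setT (EFin \o f).

Lemma lipschitz_of_derive (g dg : R -> R) (a b M : R) :
  (forall z, Num.min a b <= z <= Num.max a b -> is_derive z 1 g (dg z)) ->
  (forall z, Num.min a b <= z <= Num.max a b -> `|dg z| <= M) ->
  `|g b - g a| <= M * `|b - a|.
Proof.
wlog ab : a b / a < b => [H|].
  have [->|] := eqVneq a b; first by rewrite !subrr normr0 mulr0.
  rewrite neq_lt => /orP[ab|ba]; first exact: H.
  move=> dgz dgM; rewrite distrC (distrC b).
  by apply: H => // z; rewrite minC maxC; [exact: dgz|exact: dgM].
rewrite (min_l (ltW ab)) (max_r (ltW ab)) => dgz dgM.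
have gC : {within `[a, b], continuous g}.
  by apply: derivable_within_continuous => z; rewrite in_itv /= => /dgz[].
have [|c cI ->] := @MVT R g dg a b ab _ gC.
  by move=> z /subset_itv_oo_cc; rewrite /= in_itv /=; exact: dgz.
rewrite normrM ler_wpM2r // dgM //.
by move/subset_itv_oo_cc : cI; rewrite /= in_itv.
Qed.

(** The partial derivatives in [x] and in the rate are combinations of moments, bounded uniformly
    for rates above [b / 2]. So the moment is Lipschitz in each variable with the constant [L],
    whose last summand 1 makes it positive. *)
Lemma moment_continuous n (x b : R) : 0 < b ->
  {for (x, b), continuous (fun p : R * R => moment f n p.1 p.2)}.
Proof.
move=> b0; have b20 : 0 < b / 2 by lra.
have [M mM] : exists M, forall m y c, b / 2 <= c -> `|moment f m y c| <= M m.
  by exists (fun m => (1 + m`!%:R / (b / 2) ^+ m) * norm1 f) => m y c; exact: moment_le.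
have M0 m : 0 <= M m by apply: le_trans (mM m x b _) => //; lra.
pose L := n%:R * M n.-1 + 4 * b * M n.+1 + M n.+2 + 1.
have L0 : 0 < L.
  have h1 : 0 <= n%:R * M n.-1 by rewrite mulr_ge0.
  have h2 : 0 <= 4 * b * M n.+1 by rewrite !mulr_ge0 // ltW.
  by have h3 := M0 n.+2; rewrite /L; lra.
apply/cvgrPdist_lt => e e0.
have eL : 0 < e / (2 * L) by rewrite divr_gt0 // mulr_gt0.
have [d [d0 db dL]] := ex_pos_lt2 b20 eL.
exists (ball x d, ball b d); first by split; exact: nbhsx_ballx.
move=> [x' b'] [/=]; rewrite /ball /= => xx bb.
have b'b : b / 2 <= b' <= 2 * b by move: bb; rewrite ltr_norml; lra.
have b'0 : 0 < b' by lra.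
have X : `|moment f n x b' - moment f n x' b'| <= L * `|x - x'|.
  apply: (@lipschitz_of_derive (moment f n ^~ b')).
    by move=> z _; exact: is_derive_moment.
  move=> z _ /=; apply: (le_trans (ler_normB _ _)).
  rewrite !normrM normr_nat (@ger0_norm _ 2) // (ger0_norm (ltW b'0)).
  have h1 : n%:R * `|moment f n.-1 z b'| <= n%:R * M n.-1.
    by rewrite ler_wpM2l // mM //; lra.
  have h2 : 2 * b' * `|moment f n.+1 z b'| <= 4 * b * M n.+1.
    apply: ler_pM => //; [by rewrite mulr_ge0 // ltW|lra|].
    by apply: mM; lra.
  by have := M0 n.+2; rewrite /L; lra.
have B : `|moment f n x b - moment f n x b'| <= L * `|b - b'|.
  apply: (@lipschitz_of_derive (moment f n x) (fun c => - moment f n.+2 x c)).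
    move=> z /andP[zb _]; apply: is_derive_moment_rate => //.
    by apply: lt_le_trans zb; rewrite lt_min b'0.
  move=> z /andP[zb _]; rewrite normrN.
  have zb' : b / 2 <= z by apply: le_trans zb; rewrite le_min; apply/andP; split; lra.
  have := mM n.+2 x z zb'.
  have h1 : 0 <= n%:R * M n.-1 by rewrite mulr_ge0.
  have h2 : 0 <= 4 * b * M n.+1 by rewrite !mulr_ge0 // ltW.
  by rewrite /L; lra.
have -> : moment f n x b - moment f n x' b' =
  (moment f n x b - moment f n x b') + (moment f n x b' - moment f n x' b').
  by rewrite addrA subrK.
apply: (le_lt_trans (ler_normD _ _)).
have LE : L * (e / (2 * L)) = e / 2 by field; rewrite gt_eqF.
have X' : L * `|x - x'| < e / 2.
  apply: (@lt_le_trans _ _ (L * (e / (2 * L)))).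
    by rewrite ltr_pM2l // (lt_trans xx).
  by rewrite LE.
have B' : L * `|b - b'| < e / 2.
  apply: (@lt_le_trans _ _ (L * (e / (2 * L)))).
    by rewrite ltr_pM2l // (lt_trans bb).
  by rewrite LE.
lra.
Qed.

(** The Gaussian of variance [t] at [z] is [heat_amp t * expR (- (heat_rate t * z ^+ 2))]. *)
Definition heat_amp (t : R) : R := (Num.sqrt (2 * pi))^-1 * (Num.sqrt t)^-1.
Definition heat_rate (t : R) : R := (2 * t)^-1.

(** Closed form of F_xx: with [b] the rate, the second derivative of [expR (- (b * z ^+ 2))] is that
    exponential times [4 * b ^+ 2 * z ^+ 2 - 2 * b]. *)
Definition edge_function (x t : R) : R := heat_amp t *
  (4 * heat_rate t ^+ 2 * moment f 2 x (heat_rate t)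
   - 2 * heat_rate t * moment f 0 x (heat_rate t)).

Lemma heat_rate_gt0 t : 0 < t -> 0 < heat_rate t.
Proof. by move=> t0; rewrite invr_gt0 mulr_gt0. Qed.

Lemma heat_amp_gt0 t : 0 < t -> 0 < heat_amp t.
Proof.
by move=> t0; rewrite mulr_gt0 // invr_gt0 sqrtr_gt0 // mulr_gt0 // pi_gt0.
Qed.

Lemma scale_spaceE x t : 0 < t ->
  scale_space f x t = heat_amp t * moment f 0 x (heat_rate t).
Proof.
move=> t0; rewrite /moment -(pairingZ fI); last first.
  exact/gauss_mono_bounded_measurable/heat_rate_gt0.
apply: eq_Rintegral => y _; congr (_ * _).
rewrite /gaussian /gauss_mono /heat_amp /heat_rate expr0 mul1r sqr_sqrtr ?ltW //.
by congr (_ * expR (- _)); rewrite mulrC.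
Qed.

Lemma scale_space_xxE x t : 0 < t -> scale_space_xx f x t = edge_function x t.
Proof.
move=> t0; have b0 := heat_rate_gt0 t0.
rewrite /scale_space_xx /derive1n /=.
have -> : (fun y => scale_space f y t) =
    (fun y => heat_amp t * moment f 0 y (heat_rate t)).
  by apply/funext => y; exact: scale_spaceE.
set a := heat_amp t; set b := heat_rate t.
have D (k : R) n (y : R) : is_derive y 1 (fun y => k * moment f n y b)
    (k * (n%:R * moment f n.-1 y b - 2 * b * moment f n.+1 y b)).
  by have H := is_derive_moment fI n y b0; exact: is_deriveZ.
have -> : derive1 (fun y => a * moment f 0 y b) = (fun y => - (a * 2 * b) * moment f 1 y b).
  apply/funext => y; rewrite derive1E; have [_ ->] := D a 0%N y.
  by rewrite mul0r sub0r; ring.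
rewrite derive1E; have [_ ->] := D (- (a * 2 * b)) 1%N x.
by rewrite /edge_function -/a -/b; ring.
Qed.

Lemma edge_function_continuous : continuous_on_half_plane edge_function.
Proof.
move=> x t t0; have b0 := heat_rate_gt0 t0.
have rC : {for (x, t), continuous (fun p : R * R => heat_rate p.2)}.
  apply: cvgV; first by rewrite gt_eqF // mulr_gt0.
  by apply: cvgM; [exact: cvg_cst|exact: cvg_snd].
have aC : {for (x, t), continuous (fun p : R * R => heat_amp p.2)}.
  apply: cvgM; first exact: cvg_cst.
  apply: cvgV; first by rewrite gt_eqF // sqrtr_gt0.
  by apply: (@continuous_comp _ _ _ snd Num.sqrt); [exact: cvg_snd|exact: sqrt_continuous].
have mC n : {for (x, t), continuous (fun p : R * R => moment f n p.1 (heat_rate p.2))}.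
  apply: (@continuous_comp _ _ _ (fun p : R * R => (p.1, heat_rate p.2))
     (fun p : R * R => moment f n p.1 p.2)); last exact: moment_continuous.
  exact: (cvg_pair (@cvg_fst _ _ (nbhs x) (nbhs t) _) rC).
apply: cvgM; first exact: aC.
apply: cvgB; (apply: cvgM; last exact: mC); (apply: cvgM; first exact: cvg_cst).
  by apply: cvgM; exact: rC.
exact: rC.
Qed.

(** The witnesses are the third and fourth space derivatives of F. In time, the rate [b] and the
    amplitude [a] have derivatives [- 2 * b ^+ 2] and [- a * b], so the time derivative involves the
    same moments. *)
Lemma heat_solution_edge_function : heat_solution edge_function.
Proof.
pose b := heat_rate; pose a := heat_amp; pose m := moment f.
exists (fun x t => a t * (12 * b t ^+ 2 * m 1 x (b t) - 8 * b t ^+ 3 * m 3 x (b t))),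
  (fun x t => a t * (12 * b t ^+ 2 * m 0 x (b t) - 48 * b t ^+ 3 * m 2 x (b t)
    + 16 * b t ^+ 4 * m 4 x (b t))).
move=> x t t0; have b0 : 0 < b t by exact: heat_rate_gt0.
have D n (y : R) := is_derive_moment fI n y b0.
have D0 := D 0%N x; have D1 := D 1%N x; have D2 := D 2%N x; have D3 := D 3%N x.
split.
- by apply: is_derive_eq; rewrite /GRing.scale /= -/b -/a /m; ring.
- by apply: is_derive_eq; rewrite /GRing.scale /= -/b -/a /m; ring.
have Db : is_derive t 1 b (- (2 * b t ^+ 2)).
  have t20 : 2 * t != 0 by rewrite gt_eqF // mulr_gt0.
  have H2 : is_derive t 1 (fun t : R => 2 * t) 2.
    by apply: is_derive_eq; rewrite /GRing.scale /=; ring.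
  apply: (is_derive_eq (@is_deriveV R (fun t => 2 * t) t 2 1 t20 H2)).
  by rewrite /GRing.scale /= /b /heat_rate; field; rewrite gt_eqF.
have Da : is_derive t 1 a (- (a t * b t)).
  have st0 : Num.sqrt t != 0 by rewrite gt_eqF // sqrtr_gt0.
  have Ds := is_derive1_sqrt t0.
  have H := @is_deriveV R Num.sqrt t _ 1 st0 Ds.
  apply: (is_derive_eq (@is_deriveZ _ _ _ _ (Num.sqrt (2 * pi))^-1 _ _ _ H)).
  rewrite /GRing.scale /= /a /heat_amp /b /heat_rate.
  have -> : (2 * t)^-1 = (2 * Num.sqrt t ^+ 2)^-1 by rewrite sqr_sqrtr // ltW.
  by field; rewrite st0 gt_eqF // sqrtr_gt0 mulr_gt0 // pi_gt0.
have Dm n : is_derive t 1 (fun t => m n x (b t)) (2 * b t ^+ 2 * m n.+2 x (b t)).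
  have := @is_derive1_comp R (m n x) b t _ _ (is_derive_moment_rate fI n x b0) Db.
  by move=> H; apply: (is_derive_eq H); rewrite /m; ring.
have Dm0 := Dm 0%N; have Dm2 := Dm 2%N.
rewrite (_ : edge_function x = fun t => a t * (4 * b t ^+ 2 * m 2 x (b t)
   - 2 * b t * m 0 x (b t))) //.
by apply: is_derive_eq; rewrite /GRing.scale /=; field.
Qed.

Lemma edge_function_vanishes : vanishes_at_infinity edge_function.
Proof.
move=> t1 t2 t10 t12 e e0.
have t20 : 0 < t2 by lra.
have b20 := heat_rate_gt0 t20.
(* Amplitude and rate decrease in [t], so their values at [t1] bound the coefficients, while the
   rate at [t2] is the least one for the decay of the moments. *)
pose K := heat_amp t1 * (4 * heat_rate t1 ^+ 2 + 2 * heat_rate t1).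
have a10 := heat_amp_gt0 t10.
have b10 := heat_rate_gt0 t10.
have K0 : 0 < K by rewrite mulr_gt0 // addr_gt0 // mulr_gt0 // exprn_gt0.
have eK : 0 < e / K by rewrite divr_gt0.
have [B [B0 HB]] := moment_vanishes fI 2 b20 eK.
have [B' [B'0 HB']] := moment_vanishes fI 0 b20 eK.
exists (Num.max B B'); split; first by rewrite lt_max B0.
move=> x t /andP[tt1 tt2]; rewrite ge_max => /andP[xB xB'].
have t0 : 0 < t by lra.
have bt : heat_rate t2 <= heat_rate t.
  by rewrite lef_pV2 ?posrE ?mulr_gt0 //; lra.
have bt' : heat_rate t <= heat_rate t1.
  by rewrite lef_pV2 ?posrE ?mulr_gt0 //; lra.
have at_ : heat_amp t <= heat_amp t1.
  rewrite ler_wpM2l ?invr_ge0 ?sqrtr_ge0 //.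
  by rewrite lef_pV2 ?posrE ?sqrtr_gt0 // ler_wsqrtr.
have bt0 := heat_rate_gt0 t0; have at0 := heat_amp_gt0 t0.
have M2 := HB x _ bt xB; have M0 := HB' x _ bt xB'.
rewrite /edge_function normrM (gtr0_norm at0).
set b := heat_rate t in bt bt' bt0 M2 M0 *.
have bb : b ^+ 2 <= heat_rate t1 ^+ 2 by rewrite lerXn2r // nnegrE ltW.
have b2 : 0 < b ^+ 2 by rewrite exprn_gt0.
apply: (@lt_le_trans _ _ (heat_amp t * ((4 * b ^+ 2 + 2 * b) * (e / K)))).
  rewrite ltr_pM2l //; apply: (le_lt_trans (ler_normB _ _)).
  have p1 : 0 < 4 * b ^+ 2 by rewrite mulr_gt0.
  have p2 : 0 < 2 * b by rewrite mulr_gt0.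
  rewrite (normrM (4 * _)) (normrM (2 * _)) (gtr0_norm p1) (gtr0_norm p2).
  by rewrite (mulrDl (4 * b ^+ 2)); apply: ltrD; rewrite ltr_pM2l.
rewrite mulrA mulrA ler_pdivrMr // (mulrC e) ler_wpM2r ?(ltW e0) //.
rewrite /K ler_pM ?(ltW at0) //; first by rewrite addr_ge0 // mulr_ge0 // ltW.
by lra.
Qed.

End heat_kernel.

(** * Exponential sums and an approximation of indicators *)

Section exponential_sums.
Context {R : realType}.

Lemma exp_sum_cvg (c : R) :
  \sum_(0 <= j < n) c ^+ j / j`!%:R @[n --> \oo] --> expR c.
Proof. exact: is_cvg_series_exp_coeff. Qed.

Lemma exp_sum_le (w : R) n : 0 <= w -> \sum_(0 <= j < n) w ^+ j / j`!%:R <= expR w.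
Proof.
move=> w0; apply: (@nondecreasing_cvgn_le R (series (exp_coeff w))).
  apply/nondecreasing_seqP => k; rewrite /series /= big_nat_recr //= lerDl.
  by rewrite exp_coeffE mulr_ge0 ?exprn_ge0 // invr_ge0.
exact: is_cvg_series_exp_coeff.
Qed.

Lemma mul_expN_cvg0 (a : R) : 0 < a -> n%:R * expR (- (n%:R * a)) @[n --> \oo] --> 0.
Proof.
move=> a0; apply/cvgrPdist_lt => e e0; near=> n.
have n0 : 0 < n%:R :> R by near: n; exact: nbhs_infty_gtr.
have ne : 2 / (e * a ^+ 2) < n%:R by near: n; exact: nbhs_infty_gtr.
have ea0 : 0 < e * a ^+ 2 by rewrite mulr_gt0 // exprn_gt0.
rewrite sub0r normrN ger0_norm; last by rewrite mulr_ge0 // expR_ge0.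
rewrite expRN ltr_pdivrMr ?expR_gt0 //.
have na0 : 0 <= n%:R * a by rewrite mulr_ge0 // ltW.
have := pow_le_exp 2 na0; rewrite (_ : 2`!%:R = 2) // => ex.
have : 2 < n%:R * (e * a ^+ 2) by rewrite -ltr_pdivrMr.
nra.
Unshelve. all: by end_near. Qed.

Lemma bernoulli_le (v : R) k : 0 <= v <= 1 -> 1 - k%:R * v <= (1 - v) ^+ k.
Proof.
move=> /andP[v0 v1]; elim: k => [|k IHk]; first by rewrite mul0r subr0 expr0.
have v1' : 0 <= 1 - v by lra.
have h1 := ler_wpM2l v1' IHk.
have h2 : 0 <= k%:R * (v * v) by rewrite !mulr_ge0.
by rewrite exprS -natr1; lra.
Qed.

Lemma bernoulli_ge (v : R) k : 0 <= v <= 1 -> (1 - v) ^+ k * (1 + k%:R * v) <= 1.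
Proof.
move=> /andP[v0 v1]; elim: k => [|k IHk]; first by rewrite mul0r addr0 expr0 mulr1.
apply: le_trans IHk; rewrite exprSr -mulrA ler_wpM2l //.
  by rewrite exprn_ge0 //; lra.
have h2 : 0 <= k%:R * (v * v) by rewrite !mulr_ge0.
have h3 : 0 <= v * v by rewrite mulr_ge0.
by rewrite -natr1; lra.
Qed.

(** The exponent times [expR (- w) ^+ n] equals [n * expR (- (n * (w - ln 2)))], which tends to 0
    for [w > ln 2] and is at least [n] otherwise, thanks to the factor [n] also at [w = ln 2]. The
    two Bernoulli bounds conclude. *)
Lemma double_exp_cvg (w : R) : 0 <= w ->
  (1 - expR (- w) ^+ n) ^+ (n * 2 ^ n) @[n --> \oo] --> ((ln 2 < w)%R%:R : R).
Proof.
move=> w0.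
have v01 n : 0 <= expR (- w) ^+ n <= 1.
  by rewrite exprn_ge0 ?expR_ge0 //= exprn_ile1 ?expR_ge0 // -expR0 ler_expR oppr_le0.
have E n : (n * 2 ^ n)%:R * expR (- w) ^+ n = n%:R * expR (- (n%:R * (w - ln 2))) :> R.
  rewrite natrM natrX -mulrA -exprMn; congr (_ * _).
  by rewrite -{1}(@lnK R 2) ?posrE // -expRD -expRM_natl; congr expR; ring.
have [lw|wl] := ltP (ln 2) w => /=.
  have a0 : 0 < w - ln 2 by lra.
  apply: (@squeeze_cvgr _ _ _ _ (fun n => 1 - n%:R * expR (- (n%:R * (w - ln 2)))) (cst 1)).
  - apply: nearW => n; have /andP[v0 v1] := v01 n.
    apply/andP; split; last by rewrite exprn_ile1 //; lra.
    by rewrite -E; apply: bernoulli_le.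
  - rewrite -[X in _ --> X]subr0; apply: cvgB; first exact: cvg_cst.
    exact: mul_expN_cvg0.
  - exact: cvg_cst.
apply: (@squeeze_cvgr _ _ _ _ (cst 0) (fun n => n.+1%:R^-1)).
- apply: nearW => n; have /andP[v0 v1] := v01 n.
  apply/andP; split; first by rewrite exprn_ge0 //; lra.
  set N := (n * 2 ^ n)%N.
  have H := bernoulli_ge N (v01 n).
  have nN : n%:R <= N%:R * expR (- w) ^+ n.
    rewrite E ler_peMr // (le_trans _ (expR_ge1Dx _)) // lerDl oppr_ge0.
    by rewrite mulr_ge0_le0 //; lra.
  rewrite -[leRHS]mul1r ler_pdivlMr ?ltr0n //.
  apply: le_trans H; rewrite ler_wpM2l //; first by rewrite exprn_ge0 //; lra.
  by rewrite -natr1; lra.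
- exact: cvg_cst.
- exact: cvg_harmonic.
Qed.

(* The recursion of [r k = (2k choose k) / 4^k]. *)
Lemma central_binomial_sum_unbounded (r : nat -> R) :
  r 0%N = 1 -> (forall k, r k.+1 = (2 * k%:R + 1) / (2 * k.+1%:R) * r k) ->
  forall B, exists n, B < \sum_(0 <= k < n) r k.
Proof.
move=> r0 rS B; apply: contrapT => noB.
(* The sum then dominates half of the harmonic series. *)
have rl k : (2 * k.+1%:R)^-1 <= r k.
  elim: k => [|k IHk]; first by rewrite r0 mulr1; lra.
  have k0 : 0 <= k%:R :> R by [].
  rewrite rS; apply: (@le_trans _ _ ((2 * k%:R + 1) / (2 * k.+1%:R) * (2 * k.+1%:R)^-1)).
    rewrite -subr_ge0 -!natr1; set K := k%:R in k0 *.
    rewrite (_ : _ - _ = K / (4 * (K + 1) ^+ 2 * (K + 1 + 1))).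
      by rewrite divr_ge0 // !mulr_ge0 ?exprn_ge0 //; lra.
    by field; rewrite !gt_eqF //; lra.
  by rewrite ler_wpM2l // divr_ge0 ?mulr_ge0 //; lra.
apply: (@dvg_harmonic R).
apply: nondecreasing_is_cvgn.
  apply/nondecreasing_seqP => k; rewrite /series /= big_nat_recr //= lerDl.
  by rewrite invr_ge0.
exists (2 * B) => _ [n _ <-].
have : \sum_(0 <= k < n) r k <= B by rewrite leNgt; apply/negP => ?; apply: noB; exists n.
suff : series harmonic n <= 2 * \sum_(0 <= k < n) r k by lra.
rewrite /series /= mulr_sumr; apply: ler_sum => k _.
by have := rl k; rewrite invfM -ler_pdivrMl ?invr_gt0 // invrK mulrC.
Qed.

End exponential_sums.

(** * Zeros on an interval make all even moments vanish, at every rate *)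

Section moment_determinacy.
Context {R : realType} (f : R -> R).
Hypothesis fI : (@lebesgue_measure R).-integrable setT (EFin \o f).

Lemma derive_zero (g : R -> R) (x p q l : R) : p < x < q ->
  (forall z, p < z < q -> g z = 0) -> is_derive x 1 g l -> l = 0.
Proof.
move=> /andP[px xq] g0 dg; apply/eqP/negPn/negP => l0.
have l0' : 0 < `|l| by rewrite normr_gt0.
have [d [d0 dh]] := is_derive1P dg l0'.
have qx0 : 0 < q - x by lra.
have [h [h0 hd hq]] := ex_pos_lt2 d0 qx0.
have := dh h; rewrite gt_eqF // gtr0_norm // => /(_ isT hd).
by rewrite !g0 ?subrr ?mul0r ?sub0r ?normrN ?ltxx //; lra.
Qed.

Section vanishing_on_interval.
Variables (b p q : R).
Hypothesis b0 : 0 < b.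
Hypothesis base : forall x, p < x < q ->
  2 * b * moment f 2 x b = moment f 0 x b.

(** Even and odd relations are obtained alternately: differentiating the latest one produces the
    next, once the lowest moment is eliminated by the relation before it. *)
Lemma moment_recursion k :
  (forall x, p < x < q ->
    2 * b * moment f (2 * k).+2 x b = (2 * k%:R + 1) * moment f (2 * k) x b) /\
  (forall x, p < x < q ->
    2 * b * moment f (2 * k).+3 x b = (2 * k%:R + 3) * moment f (2 * k).+1 x b).
Proof.
pose rec n (c : R) := forall x, p < x < q ->
  2 * b * moment f n.+2 x b = c * moment f n x b.
have D n (x : R) := is_derive_moment fI n x b0.
have drec n c x : p < x < q -> rec n c ->
    2 * b * (n.+2%:R * moment f n.+1 x b - 2 * b * moment f n.+3 x b)
    = c * (n%:R * moment f n.-1 x b - 2 * b * moment f n.+1 x b).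
  move=> xI rnc; apply/eqP; rewrite -subr_eq0; apply/eqP.
  have D1 := D n.+2 x; have D2 := D n x.
  apply: (@derive_zero (fun x => 2 * b * moment f n.+2 x b - c * moment f n x b) x p q _ xI) => z zI.
  by rewrite rnc // subrr.
have simp (u v : R) : 2 * b * u = 2 * b * v -> u = v.
  by move/mulfI; apply; rewrite gt_eqF // mulr_gt0.
(* For [m = 0] there is no previous relation, but the lowest moment then has coefficient 0. *)
have even_odd m c : rec m c -> c = m%:R + 1 ->
    (m = 0%N \/ exists m', m = m'.+1 /\ rec m' c) -> rec m.+1 (c + 2).
  move=> rmc cm mm x xI; apply: simp.
  have := drec m c x xI rmc; rewrite -!natr1.
  case: mm => [m0|[m' [m'E rm']]].
    by rewrite cm m0 mul0r; lra.
  have := rm' x xI; move: cm; rewrite m'E /= => cm E.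
  have h : c * (m'.+1%:R * moment f m' x b) = m'.+1%:R * (2 * b * moment f m'.+2 x b).
    by rewrite E; ring.
  by move: h; rewrite cm -natr1; lra.
have odd_even m c : rec m.+1 c -> c = m%:R + 3 -> rec m (c - 2) -> rec m.+2 c.
  move=> rmc cm rm x xI; apply: simp.
  have := drec m.+1 c x xI rmc; rewrite -!natr1 /=.
  have E := rm x xI.
  have h : c * ((m%:R + 1) * moment f m x b) = c * (2 * b * moment f m.+2 x b).
    by rewrite E cm; ring.
  by move: h; rewrite cm; lra.
suff H : rec (2 * k)%N (2 * k%:R + 1) /\ rec (2 * k).+1 (2 * k%:R + 3) by [].
elim: k => [|k [IH1 IH2]].
  have r0 : rec 0%N (2 * 0%:R + 1) by move=> x /base ->; rewrite mulr0 add0r mul1r.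
  rewrite muln0; split => //.
  have -> : 2 * 0%:R + 3 = 2 * 0%:R + 1 + 2 :> R by ring.
  by apply: even_odd => //; [ring|left].
have IH3 : rec (2 * k).+2 (2 * k%:R + 3).
  apply: odd_even => //; first by rewrite natrM.
  by have -> : 2 * k%:R + 3 - 2 = 2 * k%:R + 1 :> R by ring.
have -> : (2 * k.+1)%N = (2 * k).+2 by rewrite mulnS.
have -> : 2 * k.+1%:R + 1 = 2 * k%:R + 3 :> R by rewrite -natr1; ring.
split => //.
have -> : 2 * k.+1%:R + 3 = 2 * k%:R + 3 + 2 :> R by rewrite -natr1; ring.
apply: even_odd => //; first by rewrite -!natr1 natrM; ring.
by right; exists (2 * k).+1.
Qed.

Lemma even_moments_vanish k x : p < x < q -> moment f (2 * k) x b = 0.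
Proof.
move=> xI.
suff m0 : moment f 0 x b = 0.
  elim: k => [//|k IHk]; have := (moment_recursion k).1 x xI.
  rewrite IHk mulr0 => /eqP; rewrite mulf_eq0 gt_eqF ?mulr_gt0 //= => /eqP <-.
  by rewrite mulnS.
apply/eqP/negPn/negP => m0.
(* Normalized so that the recursion for the moments becomes that of the central binomial
   coefficients over powers of 4. *)
pose r k := b ^+ k / k`!%:R * moment f (2 * k) x b / moment f 0 x b.
have [||n] := @central_binomial_sum_unbounded R r _ _ (norm1 f / `|moment f 0 x b|).
- by rewrite /r muln0 expr0 fact0 divr1 mul1r divff.
- move=> i; rewrite /r mulnS factS natrM exprSr.
  have E := (moment_recursion i).1 x xI.
  have : i`!%:R != 0 :> R by rewrite pnatr_eq0 -lt0n fact_gt0.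
  have : i.+1%:R != 0 :> R by rewrite pnatr_eq0.
  move: (i.+1%:R : R) (i`!%:R : R) => u v u0 v0.
  have -> : b ^+ i * b / (u * v) * moment f (2 + 2 * i) x b =
     b ^+ i / (2 * u * v) * (2 * b * moment f (2 * i).+2 x b).
    by field; rewrite u0 v0.
  by rewrite E; field; rewrite m0 u0 v0.
rewrite ltNge => /negP; apply.
have -> : \sum_(0 <= i < n) r i =
  pairing f (fun y => \sum_(0 <= i < n) (b ^+ i / i`!%:R * gauss_mono (2 * i) b (x - y)))
    / moment f 0 x b.
  rewrite (pairing_sum fI); last first.
    by move=> i; apply: bounded_measurableZ; exact: gauss_mono_bounded_measurable.
  rewrite mulr_suml; apply: eq_bigr => i _; rewrite (pairingZ fI) //.
  exact: gauss_mono_bounded_measurable.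
apply: (le_trans (ler_norm _)); rewrite normrM normfV.
rewrite ler_pM2r ?invr_gt0 ?normr_gt0 //.
rewrite -[leRHS]mul1r; apply: pairing_le => //.
  apply: bounded_measurable_sum => i; apply: bounded_measurableZ.
  exact: gauss_mono_bounded_measurable.
move=> y; have w0 : 0 <= b * (x - y) ^+ 2 by rewrite mulr_ge0 ?sqr_ge0 // ltW.
(* The integrand is a partial sum of the exponential series of [w = b * (x - y) ^+ 2] divided by
   [expR w], hence between 0 and 1. *)
have -> : \sum_(0 <= i < n) b ^+ i / i`!%:R * gauss_mono (2 * i) b (x - y) =
   (\sum_(0 <= i < n) (b * (x - y) ^+ 2) ^+ i / i`!%:R) / expR (b * (x - y) ^+ 2).
  rewrite mulr_suml; apply: eq_bigr => i _.
  by rewrite /gauss_mono expRN exprMn -exprM; ring.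
rewrite ger0_norm; last first.
  rewrite divr_ge0 ?expR_ge0 // sumr_ge0 // => i _.
  by rewrite divr_ge0 // exprn_ge0.
by rewrite ler_pdivrMr ?expR_gt0 // mul1r exp_sum_le.
Qed.

End vanishing_on_interval.

Section rates.
Variable x : R.

Definition null_moments (b : R) : Prop := forall k, moment f (2 * k) x b = 0.

(** The factor [expR ((b - l) * z ^+ 2)] is expanded in its series against the Gaussian of rate [b].
    The partial sums are dominated at rate [b - |b - l|], which is positive exactly for
    [0 < l < 2 * b]. *)
Lemma null_moments_lt_double b l : 0 < b -> null_moments b ->
  0 < l -> l < 2 * b -> null_moments l.
Proof.
move=> b0 nb l0 lb k.
pose g_ N y := \sum_(0 <= j < N) (b - l) ^+ j / j`!%:R * gauss_mono (2 * (k + j)) b (x - y).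
have bg N : bounded_measurable (g_ N).
  apply: bounded_measurable_sum => j; apply: bounded_measurableZ.
  exact: gauss_mono_bounded_measurable.
have gE N y : g_ N y = gauss_mono (2 * k) b (x - y) *
    \sum_(0 <= j < N) ((b - l) * (x - y) ^+ 2) ^+ j / j`!%:R.
  rewrite mulr_sumr; apply: eq_bigr => j _.
  by rewrite /gauss_mono mulnDr exprD exprMn -(exprM _ 2 j); ring.
have cg y : g_ N y @[N --> \oo] --> gauss_mono (2 * k) l (x - y).
  have -> : gauss_mono (2 * k) l (x - y) =
      gauss_mono (2 * k) b (x - y) * expR ((b - l) * (x - y) ^+ 2).
    by rewrite /gauss_mono -mulrA -expRD; congr (_ * expR _); ring.
  rewrite (_ : g_ ^~ y = fun N => gauss_mono (2 * k) b (x - y) *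
    \sum_(0 <= j < N) ((b - l) * (x - y) ^+ 2) ^+ j / j`!%:R); last first.
    by apply/funext => N; exact: gE.
  by apply: cvgM; [exact: cvg_cst|exact: exp_sum_cvg].
pose c := b - `|b - l|.
have c0 : 0 < c by rewrite /c subr_gt0 ltr_norml; lra.
have gM N y : `|g_ N y| <= 1 + (2 * k)`!%:R / c ^+ (2 * k).
  apply: le_trans (gauss_mono_le (2 * k) (x - y) c0 (lexx c)).
  rewrite gE normrM.
  have -> : `|gauss_mono (2 * k) c (x - y)| =
     `|gauss_mono (2 * k) b (x - y)| * expR (`|b - l| * (x - y) ^+ 2).
    rewrite /gauss_mono !normrM !(ger0_norm (expR_ge0 _)) -mulrA -expRD.
    by congr (_ * expR _); rewrite /c; ring.
  rewrite ler_wpM2l // (le_trans (ler_norm_sum _ _ _)) //.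
  have w0 : 0 <= `|b - l| * (x - y) ^+ 2 by rewrite mulr_ge0 ?sqr_ge0.
  apply: le_trans (exp_sum_le N w0); apply: ler_sum => j _.
  rewrite normrM normrX normrM (ger0_norm (sqr_ge0 _)).
  by rewrite [`|_^-1|]ger0_norm // invr_ge0.
have [_] := pairing_cvg fI (fun N => (bg N).1) gM cg.
have -> : (fun N => pairing f (g_ N)) = cst 0.
  apply/funext => N; rewrite /g_ (pairing_sum fI) /=.
    rewrite big1 // => j _; rewrite (pairingZ fI); last exact: gauss_mono_bounded_measurable.
    by rewrite -/(moment f (2 * (k + j)) x b) nb mulr0.
  by move=> j; apply: bounded_measurableZ; exact: gauss_mono_bounded_measurable.
by move/cvg_lim => L; rewrite /moment -L // lim_cst.
Qed.

(** The rates [b * (1 + n / 2)] are unbounded and each is less than twice the previous one; any [l]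
    lies below the double of one of them. *)
Lemma null_moments_all b l : 0 < b -> null_moments b -> 0 < l -> null_moments l.
Proof.
move=> b0 nb l0.
have step n : null_moments (b * (1 + n%:R / 2)).
  elim: n => [|n IHn]; first by rewrite mul0r addr0 mulr1.
  have n0 : 0 <= n%:R :> R by [].
  apply: null_moments_lt_double IHn _ _.
  - by rewrite mulr_gt0 //; lra.
  - by rewrite mulr_gt0 // -natr1; lra.
  - by rewrite mulrCA ltr_pM2l // -natr1; lra.
near \oo => n.
have ln : l / b < n%:R by near: n; exact: nbhs_infty_gtr.
have n0 : 0 <= n%:R :> R by [].
apply: null_moments_lt_double (step n) l0 _; first by rewrite mulr_gt0 //; lra.
by rewrite mulrCA -ltr_pdivrMl // mulrC; lra.
Unshelve. all: by end_near. Qed.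

Hypothesis nm : forall l, 0 < l -> null_moments l.

Lemma gauss_mono0 (l z : R) : gauss_mono 0 l z = expR (- (l * z ^+ 2)).
Proof. by rewrite /gauss_mono expr0 mul1r. Qed.

Lemma bounded_measurable1 : bounded_measurable (fun=> 1 : R).
Proof. by split; [exact: measurable_cst|exists 1 => y; rewrite normr1]. Qed.

(** The constant 1 is the bounded limit of Gaussians whose rates tend to 0. *)
Lemma null_total : pairing f (fun=> 1) = 0.
Proof.
pose g_ (n : nat) y := gauss_mono 0 (n.+1%:R^-1) (x - y).
have n0 n : 0 < n.+1%:R^-1 :> R by rewrite invr_gt0.
have bg n : bounded_measurable (g_ n) by exact: gauss_mono_bounded_measurable.
have gM n y : `|g_ n y| <= 1.
  rewrite /g_ gauss_mono0 ger0_norm ?expR_ge0 // -expR0 ler_expR oppr_le0.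
  by rewrite mulr_ge0 ?sqr_ge0 // ltW.
have cg y : g_ n y @[n --> \oo] --> (1 : R).
  rewrite -expR0 /g_ (_ : (fun n => _) =
    (fun n => expR (- (n.+1%:R^-1 * (x - y) ^+ 2)))); last first.
    by apply/funext => n; rewrite gauss_mono0.
  apply: continuous_cvg; first exact: continuous_expR.
  rewrite -oppr0; apply: cvgN; rewrite -(mul0r ((x - y) ^+ 2)).
  by apply: cvgM; [exact: cvg_harmonic|exact: cvg_cst].
have [_] := pairing_cvg fI (fun N => (bg N).1) gM cg.
have -> : (fun N => pairing f (g_ N)) = cst 0.
  by apply/funext => N; exact: (nm (n0 N) 0%N).
by move/cvg_lim => <- //; rewrite lim_cst.
Qed.

(** Splitting off one factor [1 - expR (- (l * z ^+ 2))] gives a difference of two functions of the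
    same form, at [mu] and at [mu + l]; hence the induction for all [mu]. The case [mu = 0] and
    [N = 0] is the total mass. *)
Lemma null_gaussian_powers (mu l : R) N : 0 <= mu -> 0 < l ->
  bounded_measurable (fun y => expR (- (mu * (x - y) ^+ 2)) *
    (1 - expR (- (l * (x - y) ^+ 2))) ^+ N) /\
  pairing f (fun y => expR (- (mu * (x - y) ^+ 2)) *
    (1 - expR (- (l * (x - y) ^+ 2))) ^+ N) = 0.
Proof.
move=> mu0 l0; elim: N mu mu0 => [|N IHN] mu mu0.
  have -> : (fun y => expR (- (mu * (x - y) ^+ 2)) *
    (1 - expR (- (l * (x - y) ^+ 2))) ^+ 0) = (fun y => gauss_mono 0 mu (x - y)).
    by apply/funext => y; rewrite expr0 mulr1 gauss_mono0.
  move: mu0; rewrite le_eqVlt => /predU1P[<-|mu0].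
    have -> : (fun y => gauss_mono 0 0 (x - y)) = (fun=> 1 : R).
      by apply/funext => y; rewrite gauss_mono0 mul0r oppr0 expR0.
    by split; [exact: bounded_measurable1|exact: null_total].
  split; first exact: gauss_mono_bounded_measurable.
  exact: (nm mu0 0%N).
have [b1 e1] := IHN mu mu0.
have [b2 e2] := IHN (mu + l) (addr_ge0 mu0 (ltW l0)).
have -> : (fun y => expR (- (mu * (x - y) ^+ 2)) *
    (1 - expR (- (l * (x - y) ^+ 2))) ^+ N.+1) =
  (fun y => expR (- (mu * (x - y) ^+ 2)) * (1 - expR (- (l * (x - y) ^+ 2))) ^+ N +
   (-1) * (expR (- ((mu + l) * (x - y) ^+ 2)) * (1 - expR (- (l * (x - y) ^+ 2))) ^+ N)).
  by apply/funext => y; rewrite (exprS _ N) (mulrDl mu l) opprD expRD; ring.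
split; first exact/bounded_measurableD/bounded_measurableZ.
rewrite (pairingD fI) ?(pairingZ fI) ?e1 ?e2 ?mulr0 ?addr0 //.
exact: bounded_measurableZ.
Qed.

Lemma null_outside (r : R) : 0 < r ->
  bounded_measurable (fun y => (r < `|x - y|)%R%:R : R) /\
  pairing f (fun y => (r < `|x - y|)%R%:R) = 0.
Proof.
(* This [l] places the threshold [ln 2] for [l * (x - y) ^+ 2] at distance [r] from [x]. *)
move=> r0; pose l := ln 2 / r ^+ 2.
have l0 : 0 < l by rewrite divr_gt0 ?exprn_gt0 // ln_gt0 // ltr1n.
pose g_ (n : nat) y := (1 - expR (- (l * (x - y) ^+ 2)) ^+ n) ^+ (n * 2 ^ n).
have w0 y : 0 <= l * (x - y) ^+ 2 by rewrite mulr_ge0 ?sqr_ge0 // ltW.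
have bg n : bounded_measurable (g_ n) /\ pairing f (g_ n) = 0.
  (* For [n = 0] the rate [n * l] is not positive, but the outer exponent is 0 and the function is
     constant 1. *)
  case: n => [|n].
    rewrite (_ : g_ 0%N = fun=> 1); last by apply/funext => y; rewrite /g_ mul0n expr0.
    by split; [exact: bounded_measurable1|exact: null_total].
  have nl0 : 0 < n.+1%:R * l by rewrite mulr_gt0.
  have [] := null_gaussian_powers (n.+1 * 2 ^ n.+1) (lexx 0) nl0.
  have -> : (fun y => expR (- (0 * (x - y) ^+ 2)) *
    (1 - expR (- (n.+1%:R * l * (x - y) ^+ 2))) ^+ (n.+1 * 2 ^ n.+1)) = g_ n.+1.
    apply/funext => y; rewrite mul0r oppr0 expR0 mul1r /g_ -expRM_natl.
    by congr ((1 - expR _) ^+ _); ring.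
  by [].
have gM n y : `|g_ n y| <= 1.
  have v0 := expR_ge0 (- (l * (x - y) ^+ 2)).
  have v1 : expR (- (l * (x - y) ^+ 2)) ^+ n <= 1.
    by rewrite exprn_ile1 // -expR0 ler_expR oppr_le0.
  have v0n : 0 <= expR (- (l * (x - y) ^+ 2)) ^+ n by rewrite exprn_ge0.
  rewrite ger0_norm; first by rewrite exprn_ile1 //; lra.
  by rewrite exprn_ge0 //; lra.
have cg y : g_ n y @[n --> \oo] --> ((r < `|x - y|)%R%:R : R).
  have -> : (r < `|x - y|) = (ln 2 < l * (x - y) ^+ 2).
    rewrite /l mulrAC ltr_pdivlMr ?exprn_gt0 // ltr_pM2l ?ln_gt0 ?ltr1n //.
    by rewrite -[X in _ = (_ < X)]real_normK ?num_real // ltr_pXn2r ?nnegrE ?(ltW r0).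
  exact: double_exp_cvg.
have [bh] := pairing_cvg fI (fun n => (bg n).1.1) gM cg.
have -> : (fun n => pairing f (g_ n)) = cst 0.
  by apply/funext => n; exact: (bg n).2.
by move/cvg_lim => <- //; rewrite lim_cst.
Qed.

End rates.
End moment_determinacy.

(** * Symmetry of the distribution function forces [f] to vanish *)

Lemma derive1_locally_constant {R : realType} (g : R -> R) (x d : R) :
  derivable g x 1 -> 0 < d -> (forall z, `|z - x| < d -> g z = g x) ->
  derive1 g x = 0.
Proof.
move=> dg d0 gx.
have H : is_derive x 1 g (derive1 g x) by apply: DeriveDef => //; rewrite derive1E.
have H' := is_deriveB H (is_derive_cst (g x) x (1 : R)).
have := @derive_zero R _ x (x - d) (x + d) _ _ _ H'.
rewrite subr0; apply; first by lra.
by move=> z zI; rewrite fctE /= gx ?subrr // ltr_norml; lra.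
Qed.

Section vanishing_masses.
Context {R : realType} (f : R -> R).
Hypothesis fI : (@lebesgue_measure R).-integrable setT (EFin \o f).

Let S (z : R) : R := \int[@lebesgue_measure R]_(y in `]-oo, z]) f y.

Lemma pairing_indicator (P : R -> bool) :
  pairing f (fun y => (P y)%:R) = \int[@lebesgue_measure R]_(y in [set y | P y]) f y.
Proof.
rewrite Rintegral_mkcond; apply: eq_Rintegral => y _; rewrite patchE.
case: ifPn; rewrite ?inE => Py; first by rewrite Py mulr1.
by rewrite (_ : P y = false) ?mulr0 //; apply/negP => /= /mem_set; exact/negP.
Qed.

Lemma mass_le (z : R) : pairing f (fun y => (y <= z)%R%:R) = S z.
Proof.
by rewrite pairing_indicator; congr Rintegral.
Qed.

Lemma mass_lt (z : R) : pairing f (fun y => (y < z)%R%:R) = S z.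
Proof.
rewrite /S -Rintegral_itv_bndo_bndc; last exact: integrableS fI.
by rewrite pairing_indicator; congr Rintegral.
Qed.

Lemma bounded_measurable_le (z : R) : bounded_measurable (fun y => (y <= z)%R%:R : R).
Proof.
split; last by exists 1 => y; case: (y <= z); rewrite ?normr1 ?normr0.
rewrite (_ : (fun y => _) = \1_(`]-oo, z] : set R)); first exact: measurable_indic.
by apply/funext => y; rewrite indicE mem_setE in_itv.
Qed.

Lemma bounded_measurable_lt (z : R) : bounded_measurable (fun y => (y < z)%R%:R : R).
Proof.
split; last by exists 1 => y; case: (y < z); rewrite ?normr1 ?normr0.
rewrite (_ : (fun y => _) = \1_(`]-oo, z[ : set R)); first exact: measurable_indic.
by apply/funext => y; rewrite indicE mem_setE in_itv.
Qed.

(* The mass of the complement of every interval centred at x vanishes, as does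
   the total mass. *)
Lemma mass_symmetric (x : R) : (forall l, 0 < l -> null_moments f x l) ->
  forall r, S (x + r) = S (x - r).
Proof.
move=> nm.
suff H r : 0 < r -> S (x + r) = S (x - r).
  move=> r; have [r0|r0|<-] := ltgtP 0 r; first exact: H.
    by have := H (- r); rewrite oppr_gt0 opprK => ->.
  by rewrite addr0 subr0.
move=> r0.
have [_] := null_outside fI nm r0.
have -> : (fun y => (r < `|x - y|)%R%:R) =
    (fun y => (y < x - r)%R%:R + (1 + (-1) * (y <= x + r)%R%:R)) :> (R -> R).
  apply/funext => y; rewrite ltr_normr.
  have -> : (r < x - y) = (y < x - r) by apply/idP/idP; lra.
  have -> : (r < - (x - y)) = ~~ (y <= x + r) by rewrite -ltNge; apply/idP/idP; lra.
  have [/= yx|yx] := ltP y (x - r).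
    have -> : y <= x + r by lra.
    by rewrite mulr1 subrr addr0.
  by case: (y <= x + r); rewrite ?mulr1 ?mulr0 ?subrr ?add0r ?addr0.
have bl := bounded_measurable_le (x + r).
have b1 := @bounded_measurable1 R.
rewrite (pairingD fI (bounded_measurable_lt _)); last first.
  exact/bounded_measurableD/bounded_measurableZ.
rewrite (pairingD fI b1 (bounded_measurableZ _ bl)) (pairingZ fI _ bl).
by rewrite (null_total fI nm) mass_le mass_lt add0r mulN1r => /eqP; rewrite subr_eq0 => /eqP.
Qed.

(** Two reflections compose to a translation, so [S] has all small periods and is locally constant;
    almost everywhere its derivative is [f]. *)
Lemma ae0_of_symmetric_masses (p q : R) : p < q ->
  (forall x, p < x < q -> forall r, S (x + r) = S (x - r)) ->
  {ae (@lebesgue_measure R), forall x, f x = 0}.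
Proof.
move=> pq sym.
have per h w : 0 < h -> h < q - p -> S (w + h) = S w.
  move=> h0 hq.
  (* The centres are [h / 2] apart, so that reflecting in one and then in the other translates by
     [h]. *)
  have x1 : p < (p + q) / 2 - h / 4 < q by lra.
  have x2 : p < (p + q) / 2 + h / 4 < q by lra.
  have := sym _ x2 (w + h - ((p + q) / 2 + h / 4)); rewrite subrKC => ->.
  have := sym _ x1 (((p + q) / 2 - h / 4) - w); rewrite subKr => <-.
  by congr S; lra.
have Sloc w z : `|z - w| < q - p -> S z = S w.
  have [zw|wz|->] := ltgtP z w; last by [].
  - by move=> zw'; have := @per (w - z) z; rewrite subrKC => -> //; move: zw'; rewrite ltr_norml; lra.
  - by move=> zw'; have := @per (z - w) w; rewrite subrKC => -> //; move: zw'; rewrite ltr_norml; lra.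
have loc : locally_integrable setT f by apply: open_integrable_locally => //; exact: openT.
have int y : (@lebesgue_measure R).-integrable `]-oo, y] (EFin \o f) by exact: integrableS fI.
have := FTC1Ny int loc.
apply: filterS; first exact: (ae_filter_ringOfSetsType lebesgue_measure).
move=> x [dS <-].
have qp : 0 < q - p by lra.
apply: (derive1_locally_constant dS qp) => z zx.
exact: Sloc.
Qed.

End vanishing_masses.

(** * Application to the edge contours of [f] *)

Lemma edge_function_not_null {R : realType} (f : R -> R) (t a b : R) :
  (@lebesgue_measure R).-integrable setT (EFin \o f) ->
  ~ {ae (@lebesgue_measure R), forall x, f x = 0} ->
  0 < t -> a < b -> exists y, a < y < b /\ edge_function f y t != 0.
Proof.
move=> fI f0 t0 ab; apply: contrapT => noy; apply: f0.
have b0 := heat_rate_gt0 t0.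
(* After division by the amplitude and by [2 * heat_rate t], the vanishing of [edge_function] is the
   initial relation of the moment recursion. *)
have base x : a < x < b ->
    2 * heat_rate t * moment f 2 x (heat_rate t) = moment f 0 x (heat_rate t).
  move=> xI; have : edge_function f x t = 0.
    by apply/eqP/negPn/negP => ?; apply: noy; exists x.
  move/eqP; rewrite mulf_eq0 gt_eqF ?heat_amp_gt0 //= subr_eq0 => /eqP E.
  have h20 : 2 * heat_rate t != 0 by rewrite gt_eqF // mulr_gt0.
  by apply: (mulfI h20); rewrite -E; ring.
apply: (ae0_of_symmetric_masses fI ab) => x xI; apply: mass_symmetric => // l l0.
apply: (null_moments_all fI b0) l0 => k.
exact: (even_moments_vanish fI b0 base).
Qed.

Unset Implicit Arguments.

Theorem theorem7 (R : realType) (gamma : R) (f : R -> R)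
    (CC : set (set (R * R))) (t1 t2 : R) :
  0 < gamma ->
  Pdual_L1 gamma f ->
  ~ {ae (@lebesgue_measure R), forall x, f x = 0} ->
  edge_contours f CC ->
  0 < t1 -> t1 < t2 ->
  contours_meeting CC t2 `<=` contours_meeting CC t1.
Proof.
move=> _ [fI _] f0 [_ CCc _] t10 t12 C [CCC Ct2]; split => //.
have := CCc C CCC.
have -> : edge_set f = [set p | upper_half_plane p /\ edge_function f p.1 p.2 = 0].
  by apply/seteqP; split => p [p0 E]; split => //; move: E;
    rewrite (scale_space_xxE fI).
move=> Cc; apply: (contour_curve_descends _ _ _ _ Cc t10 t12 Ct2).
- exact: edge_function_continuous.
- exact: heat_solution_edge_function.
- exact: edge_function_vanishes.
- by move=> t a b; exact: edge_function_not_null.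
Qed.
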